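(* Let $\mu$ be a balanced measure on $\mathbb{R}$ and let $N\ge0$ be an integer. There exist $\eta\in(0,1)$ and $C>0$, depending only on $\mu$ and $N$, such that the following holds for all nonnegative integers $s,t$ with $s+t\le N$: for every $T\in\mathrm{HS}(s,t)$ and each pair of compactly supported, bounded, nonnegative functions $f_1,f_2$ there exists an $\eta$-sparse collection $\mathcal{S}\subset\mathscr{D}$ such that $$|\langle Tf_1,f_2\rangle|\le C\big(\mathcal{A}_{\mathcal{S}}(f_1,f_2)+\mathcal{C}^N_{\mathcal{S}}(f_1,f_2)\big).$$
   Context: $\mathscr{D}$ is the standard dyadic system of half-open intervals $2^{-k}[j,j+1)$, $j,k\in\mathbb{Z}$. For $I\in\mathscr{D}$, $I_-$ and $I_+$ are its left and right dyadic children, $\widehat{I}$ its dyadic parent, and $I^{(j)}$ its $j$-th dyadic ancestor ($I^{(0)}=I$); $\mathscr{D}_j(I)=\{J\in\mathscr{D}:J^{(j)}=I\}$. The dyadic distance is $\operatorname{dist}_{\mathscr{D}}(I,J)=\min\{s+t:\ s,t\ge0,\ I^{(s)}=J^{(t)}\}$, and $=\infty$ if $I,J$ have no common dyadic ancestor. $\mu$ is a Borel measure on $\mathbb{R}$ with $0<\mu(I)<\infty$ for all $I\in\mathscr{D}$. Pairings and averages are with respect to $\mu$: $\langle f,g\rangle=\int fg\,d\mu$, $\langle f\rangle_I=\mu(I)^{-1}\int_I f\,d\mu$. Set $m(I)=\mu(I_-)\mu(I_+)/\mu(I)$. The measure $\mu$ is balanced if it has no atoms and there is $c\ge1$ with $c^{-1}m(\widehat{I})\le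 m(I)\le c\,m(\widehat{I})$ for all $I\in\mathscr{D}$. The Haar function of $I$ is $h_I=\sqrt{m(I)}\left(\frac{1_{I_-}}{\mu(I_-)}-\frac{1_{I_+}}{\mu(I_+)}\right)$. $\mathrm{HS}(s,t)$ is the family of Haar shifts of complexity $(s,t)$, i.e. operators on $L^2(\mu)$ of the form $Tf=\sum_{I\in\mathscr{D}}\sum_{J\in\mathscr{D}_s(I)}\sum_{K\in\mathscr{D}_t(I)}\alpha^I_{J,K}\langle f,h_J\rangle h_K$ with $\sup|\alpha^I_{J,K}|\le1$. A collection $\mathcal{S}\subset\mathscr{D}$ is $\eta$-sparse if for each $I\in\mathcal{S}$ there is a measurable $E_I\subset I$ with $\mu(E_I)\ge\eta\mu(I)$ and the sets $\{E_I\}_{I\in\mathcal{S}}$ are pairwise disjoint. The forms are $$\mathcal{A}_{\mathcal{S}}(f_1,f_2)=\sum_{I\in\mathcal{S}}\langle f_1\rangle_I\langle f_2\rangle_I\mu(I),\qquad \mathcal{C}^N_{\mathcal{S}}(f_1,f_2)=\sum_{\substack{J,K\in\mathcal{S}:\ J\cap K=\emptyset\\ 2<\operatorname{dist}_{\mathscr{D}}(J,K)\le N+2}}\langle f_1\rangle_J\langle f_2\rangle_K\sqrt{m(J)}\sqrt{m(K)}.$$ *)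

(* Defs.v *)
From HB Require Import structures.
From mathcomp Require Import all_boot all_order all_algebra finmap.
From mathcomp Require Import all_classical all_reals all_analysis.
From mathcomp Require Import lra.
From mathcomp.analysis.showcase Require Import summability.

Set Implicit Arguments.
Unset Strict Implicit.
Unset Printing Implicit Defensive.
Import Order.TTheory GRing.Theory Num.Theory.
Import numFieldNormedType.Exports.

Local Open Scope classical_set_scope.
Local Open Scope ring_scope.

(* [(k, j)] stands for the interval 2^-k [j, j + 1). By [ditv_inj] below,
   equality of pairs is equality of intervals. *)
Definition dyadic : Type := (int * int)%type.

Definition ditv (R : realType) (I : dyadic) : set R :=
  `[ 2%:R ^ (- I.1) * I.2%:~R, 2%:R ^ (- I.1) * (I.2 + 1)%:~R [%classic.
Arguments ditv : clear implicits.

Definition dleft (I : dyadic) : dyadic := (I.1 + 1, I.2 * 2).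
Definition dright (I : dyadic) : dyadic := (I.1 + 1, I.2 * 2 + 1).

(* [divz] rounds down for a positive divisor, also when [I.2 < 0]. *)
Definition dparent (I : dyadic) : dyadic := (I.1 - 1, (I.2 %/ 2)%Z).

Lemma ditvU (R : realType) (I : dyadic) :
  ditv R I = ditv R (dleft I) `|` ditv R (dright I).
Proof.
have h : (2%:R : R) ^ (- (I.1 + 1)) = 2%:R ^ (- I.1) / 2%:R.
  by rewrite opprD expfzDr ?pnatr_eq0 // expN1r.
have p : 0 < (2%:R : R) ^ (- I.1) by rewrite exprz_gt0.
apply/seteqP; split => x; rewrite /ditv /= !in_itv /= h !(intrD, intrM); set a := _ ^ _ in p *; set j := I.2%:~R.
- move=> /andP[A B]; case: (ltP x (a / 2%:R * (j * 2%:~R + 1))) => H; [left|right]; apply/andP; split; lra.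
- case=> /andP[A B]; apply/andP; split; lra.
Qed.

Lemma dparent_left I : dparent (dleft I) = I.
Proof. by case: I => k j; rewrite /dparent /dleft /= addrK mulzK. Qed.

Lemma dparent_right I : dparent (dright I) = I.
Proof. by case: I => k j; rewrite /dparent /dright /= addrK divzMDl // addr0. Qed.

Lemma ditv_inj (R : realType) : injective (@ditv R).
Proof.
have e k : 0 < (2%:R : R) ^ k by rewrite exprz_gt0.
move=> [k j] [l i] /= H.
have ne k0 j0 : ditv R (k0, j0) (2%:R ^ (- k0) * j0%:~R).
  by rewrite /ditv /= in_itv /= lexx /= ltr_pM2l // ltr_int ltzD1.
have a1 := ne k j; rewrite H in a1.
have a2 := ne l i; rewrite -H in a2.
have E1 : (2%:R : R) ^ (- k) * j%:~R = 2%:R ^ (- l) * i%:~R.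
  move: a1 a2; rewrite /ditv /= !in_itv /= => /andP[A _] /andP[B _].
  by apply/eqP; rewrite eq_le A B.
have E2 : (2%:R : R) ^ (- k) * (j + 1)%:~R = 2%:R ^ (- l) * (i + 1)%:~R.
  have up x (k' j' l' i' : int) : ditv R (k', j') `<=` ditv R (l', i') ->
     ditv R (k', j') x -> (2%:R : R) ^ (- k') * (j' + 1)%:~R <= 2%:R ^ (- l') * (i' + 1)%:~R.
    rewrite /ditv /= => sub; rewrite in_itv /= => /andP[X1 X2].
    rewrite leNgt; apply/negP => lt.
    set b := _ * _ in lt.
    set y := Num.max x b.
    have : `[2%:R ^ (- k') * j'%:~R, 2%:R ^ (- k') * (j' + 1)%:~R[%classic y.
      by rewrite /= in_itv /= /y le_max X1 /= gt_max X2 lt.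
    by move/sub; rewrite /= in_itv /= /y gt_max -/b ltxx !andbF.
  apply/eqP; rewrite eq_le (up _ _ _ _ _ _ (ne k j)) ?H// (up _ _ _ _ _ _ (ne l i)) ?H//.
have E3 : (2%:R : R) ^ (- k) = 2%:R ^ (- l).
  by move: E1 E2; rewrite !intrD; lra.
have E4 : k = l.
  apply: oppr_inj; apply: (@ieexprIz R 2%:R) => //.
  by rewrite (eqr_nat R 2 1).
subst l; congr pair; apply: (@intr_inj R); apply: (mulfI _ E1); by rewrite gt_eqF.
Qed.

Definition dancestor (n : nat) (I : dyadic) : dyadic := iter n dparent I.
Definition descendants (n : nat) (I : dyadic) : set dyadic :=
  [set J | dancestor n J = I].

Definition ddist (R : realType) (I J : dyadic) : \bar R :=
  ereal_inf [set ((p.1 + p.2)%:R)%:E | p in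
    [set p : nat * nat | dancestor p.1 I = dancestor p.2 J]].
Arguments ddist : clear implicits.

Definition vol (R : realType) (mu : {measure set (measurableTypeR R) -> \bar R})
    (I : dyadic) : R :=
  fine (mu (ditv R I)).

Definition pairing (R : realType)
    (mu : {measure set (measurableTypeR R) -> \bar R}) (f g : R -> R) : R :=
  \int[mu]_x (f x * g x).

Definition average (R : realType)
    (mu : {measure set (measurableTypeR R) -> \bar R}) (f : R -> R)
    (I : dyadic) : R :=
  (vol mu I)^-1 * \int[mu]_(x in ditv R I) f x.

Definition mass (R : realType)
    (mu : {measure set (measurableTypeR R) -> \bar R}) (I : dyadic) : R :=
  vol mu (dleft I) * vol mu (dright I) / vol mu I.

Definition balanced (R : realType)
    (mu : {measure set (measurableTypeR R) -> \bar R}) : Prop :=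
  (forall x : R, mu [set x] = 0%E) /\
  exists2 c : R, 1 <= c &
    forall I : dyadic,
      c^-1 * mass mu (dparent I) <= mass mu I <= c * mass mu (dparent I).

Definition haar (R : realType)
    (mu : {measure set (measurableTypeR R) -> \bar R}) (I : dyadic) (x : R) : R :=
  Num.sqrt (mass mu I) *
  (\1_(ditv R (dleft I)) x / vol mu (dleft I)
   - \1_(ditv R (dright I)) x / vol mu (dright I)).

Definition haar_block (R : realType)
    (mu : {measure set (measurableTypeR R) -> \bar R}) (s t : nat)
    (alpha : dyadic -> dyadic -> dyadic -> R) (f : R -> R) (I : dyadic)
    (x : R) : R :=
  \sum_(J \in descendants s I) \sum_(K \in descendants t I)
    alpha I J K * pairing mu f (haar mu J) * haar mu K x.

(* An operator on L^2(mu) acts on representatives; its values outside L^2(mu)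
   are irrelevant. The series over all dyadic [I] converges in L^2(mu) along the
   net of finite sets of intervals, i.e. unconditionally. *)
Definition HS (R : realType)
    (mu : {measure set (measurableTypeR R) -> \bar R}) (s t : nat)
    (T : (R -> R) -> (R -> R)) : Prop :=
  exists2 alpha : dyadic -> dyadic -> dyadic -> R,
    (forall I J K, descendants s I J -> descendants t I K ->
       `|alpha I J K| <= 1) &
    forall f : R -> R, f \in Lfun mu 2%:E ->
      T f \in Lfun mu 2%:E /\
      (fun F : {fset dyadic} =>
         Lnorm mu 2%:E
           (fun x => (T f x - \sum_(I <- F) haar_block mu s t alpha f I x)%:E))
        @ totally --> 0%E.

Definition sparse (R : realType)
    (mu : {measure set (measurableTypeR R) -> \bar R}) (eta : R)
    (S : set dyadic) : Prop :=
  exists2 E : dyadic -> set (measurableTypeR R),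
    (forall I, S I ->
       [/\ measurable (E I), E I `<=` ditv R I &
           (eta%:E * mu (ditv R I) <= mu (E I))%E]) &
    trivIset S E.

(* The forms are sums of nonnegative terms, possibly infinite, when [f1] and
   [f2] are nonnegative; [esum] is used only in that case. *)
Definition sparse_form (R : realType)
    (mu : {measure set (measurableTypeR R) -> \bar R}) (S : set dyadic)
    (f1 f2 : R -> R) : \bar R :=
  \esum_(I in S) (average mu f1 I * average mu f2 I * vol mu I)%:E.

Definition cross_form (R : realType)
    (mu : {measure set (measurableTypeR R) -> \bar R}) (N : nat)
    (S : set dyadic) (f1 f2 : R -> R) : \bar R :=
  \esum_(p in [set p : dyadic * dyadic |
      [/\ S p.1, S p.2,
          ditv R p.1 `&` ditv R p.2 = set0 &
          (2%:E < ddist R p.1 p.2 <= ((N + 2)%:R)%:E)%E]])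
    (average mu f1 p.1 * average mu f2 p.2 *
     Num.sqrt (mass mu p.1) * Num.sqrt (mass mu p.2))%:E.

Definition test_fun (R : realType) (f : R -> R) : Prop :=
  [/\ measurable_fun setT f, forall x, 0 <= f x, bounded_fun f &
      compact (closure [set x | f x != 0])].

(* Main.v *)
(** Stopping intervals are chosen from two large roots, one for each half-line,
    by stopping whenever the average of f1 or of f2 exceeds four times its
    average over the current stopping interval; they form a 1/2-sparse family.
    Since <f, h_J> is the square root of m(J) times the difference of the
    averages of f over the children of J, the terms of the dual form split in
    two. When the four children of J and K have the same stopping interval V,
    AM-GM reduces to sums of m(J) (<f>_{J-} - <f>_{J+})^2 over J in the corona
    of V; these are squares of good parts of a Calderon-Zygmund decomposition,
    bounded by <f>_V times the integral of f over V by telescoping a convex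
    function. Otherwise some stopping interval lies between the common ancestor
    of J and K and one of these children. By balancedness m(J) and m(K) are then
    comparable to the mass of any interval in between, so the term is dominated
    either by two disjoint stopping intervals at distance at most N + 2, or, when
    these are nested or siblings, by a stopping interval W together with the
    stopping interval above its parent; the latter sums to the sparse form.
    Sums are finite until the end, with a constant B bounding all finite partial
    sums of both forms: the Haar shift converges along finite sets. *)

Require Import Defs.
From mathcomp Require Import all_boot all_order all_algebra.
From mathcomp Require Import all_classical all_reals all_analysis.
From mathcomp Require Import measurable_realfun finmap zify ring lra.
From mathcomp.analysis.showcase Require summability.
Import Order.TTheory GRing.Theory Num.Theory.

Local Open Scope classical_set_scope.
Local Open Scope ring_scope.

Set Implicit Arguments.
Unset Strict Implicit.
Unset Printing Implicit Defensive.

(** * Ancestors and the inclusion order on codes of intervals *)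

Lemma dchild_parent u : u = dleft (dparent u) \/ u = dright (dparent u).
Proof.
case: u => k j; rewrite /dleft /dright /dparent /= subrK.
have := divz_eq j 2; have := modz_ge0 j (d := 2) isT; have := @ltz_pmod j 2 isT.
case: (j %% 2)%Z => [[|[|//]]|//] _ _ E; [left|right];
  by rewrite {1}E ?addr0.
Qed.

Lemma dleft_neq_right I : dleft I <> dright I.
Proof. by case: I => k j /(congr1 snd) /=; lia. Qed.

Lemma dancestorS n u : dancestor n.+1 u = dparent (dancestor n u).
Proof. by []. Qed.

Lemma dancestorSr n u : dancestor n.+1 u = dancestor n (dparent u).
Proof. exact: iterSr. Qed.

Lemma dancestorD m n u : dancestor (m + n) u = dancestor m (dancestor n u).
Proof. exact: iterD. Qed.

Lemma dancestor1 n u : (dancestor n u).1 = u.1 - n%:Z.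
Proof. elim: n u => [|n IH] u; [rewrite subr0 //|rewrite dancestorSr IH /=; lia]. Qed.

Lemma dancestor_inj m n u : dancestor m u = dancestor n u -> m = n.
Proof. by move=> /(congr1 fst); rewrite !dancestor1; lia. Qed.

Definition under (u V : dyadic) := exists n, dancestor n u = V.

Lemma under_refl u : under u u. Proof. by exists 0%N. Qed.

Lemma under_trans u v w : under u v -> under v w -> under u w.
Proof. by move=> [n <-] [m <-]; exists (m + n)%N; rewrite dancestorD. Qed.

Lemma under_parent u : under u (dparent u). Proof. by exists 1%N. Qed.

Lemma under_parentP u v : under u v -> u <> v -> under (dparent u) v.
Proof. by move=> [[|n] <-] // _; exists n; rewrite dancestorSr. Qed.

Lemma under_left u : under (dleft u) u.
Proof. by exists 1%N; rewrite /= dparent_left. Qed.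

Lemma under_right u : under (dright u) u.
Proof. by exists 1%N; rewrite /= dparent_right. Qed.

Lemma under_left_irr u : ~ under u (dleft u).
Proof. by move=> [n /(congr1 fst)]; rewrite dancestor1 /=; lia. Qed.

Lemma under_right_irr u : ~ under u (dright u).
Proof. by move=> [n /(congr1 fst)]; rewrite dancestor1 /=; lia. Qed.

(** The half-line containing an interval *)

(** The value is an index: [(k, 0)] and [(k, -1)] are the intervals of level [k] adjacent to the
    origin, and [(k, dsign u)] is the one on the side of [u]. *)
Definition dsign (u : dyadic) : int := if 0 <= u.2 then 0 else -1.

Lemma dsign_parent u : dsign (dparent u) = dsign u.
Proof. by rewrite /dsign /=; case: u => k j /=; do 2 case: ifP; lia. Qed.

Lemma dsign_ancestor n u : dsign (dancestor n u) = dsign u.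
Proof. by elim: n => //= n IH; rewrite dsign_parent. Qed.

Lemma dsign_under u v : under u v -> dsign u = dsign v.
Proof. by move=> [n <-]; rewrite dsign_ancestor. Qed.

(** Floored halving strictly decreases the absolute value of an index until it reaches a fixed
    point, 0 or -1. *)
Lemma dancestor_sign n u : (`|u.2| <= n)%N ->
  dancestor n u = (u.1 - n%:Z, dsign u).
Proof.
elim: n u => [|n IH] [k j] h.
  by rewrite subr0 /dsign; congr pair; case: ifP h => /=; lia.
have [z|z] := eqVneq (j %/ 2)%Z j.
  have e m : dancestor m (k, j) = (k - m%:Z, j).
    elim: m => [|m E]; first by rewrite subr0.
    by rewrite dancestorS E /dparent /= z; congr pair; lia.
  by rewrite e /dsign; congr pair; case: ifP => /=; lia.
rewrite dancestorSr IH; last by move: h => /=; lia.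
by rewrite dsign_parent; congr pair => /=; lia.
Qed.

Lemma dancestor_dsign n r u : dancestor n (r, dsign u) = (r - n%:Z, dsign u).
Proof.
elim: n => [|n E]; first by rewrite subr0.
rewrite dancestorS E /dparent /=; congr pair; first lia.
by rewrite /dsign; case: ifP.
Qed.

Lemma dsign_idem r u : dsign (r, dsign u) = dsign u.
Proof. by rewrite /dsign /=; case: (0 <= u.2). Qed.

Lemma common_ancestor (L : seq dyadic) (r e : int) :
    (forall x, x \in L -> dsign x = e) ->
  exists n : nat, forall x, x \in L -> under x (r - n%:Z, e).
Proof.
elim: L => [|x L IH] H; first by exists 0%N.
have [|n Hn] := IH; first by move=> y yL; apply: H; rewrite inE yL orbT.
have es : dsign x = e by apply: H; rewrite inE eqxx.
(* With this [a], the number [b] of steps up from [x] is at least [|x.2|], so that the index of [x]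
   has become [e]. *)
pose a := (`|x.2| + `|x.1| + `|r|)%N.
exists (n + a)%N => y; rewrite inE => /predU1P[->|yL]; last first.
  apply: under_trans (Hn y yL) _; exists a; rewrite -es dancestor_dsign.
  by congr pair; lia.
pose b := absz (x.1 - r + n%:Z + a%:Z).
exists b; rewrite dancestor_sign ?es; last by rewrite /b /a; lia.
by congr pair; rewrite /b /a; lia.
Qed.

(** Descendants and tree sums *)

Fixpoint dlist (n : nat) (I : dyadic) : seq dyadic :=
  if n is m.+1 then dlist m (dleft I) ++ dlist m (dright I) else [:: I].

Lemma mem_dlist n I J : (J \in dlist n I) = (dancestor n J == I).
Proof.
elim: n I => [|n IH] I /=; first by rewrite inE.
rewrite mem_cat !IH -/(dancestor n J); apply/orP/eqP => [[]/eqP->|].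
- exact: dparent_left.
- exact: dparent_right.
by move=> <-; case: (dchild_parent (dancestor n J)) => <-; rewrite eqxx; [left|right].
Qed.

Lemma dlist_uniq n I : uniq (dlist n I).
Proof.
elim: n I => [|n IH] I //=; rewrite cat_uniq !IH andbT /=; apply/hasPn => J.
by rewrite !mem_dlist => /eqP->; apply/eqP => /esym/dleft_neq_right.
Qed.

Lemma size_dlist n I : size (dlist n I) = (2 ^ n)%N.
Proof. by elim: n I => //= n IH I; rewrite size_cat !IH expnS mul2n addnn. Qed.

Lemma uniq_dlist_flatten n (F : seq dyadic) :
  uniq F -> uniq (flatten [seq dlist n x | x <- F]).
Proof.
elim: F => //= I F IH /andP[IF uF]; rewrite cat_uniq dlist_uniq IH// andbT /=.
apply/hasPn => J /flatten_mapP[I' I'F]; rewrite !mem_dlist => /eqP->.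
by apply: contraNneq IF => <-.
Qed.

Section TreeSum.
Variable R : realFieldType.
Implicit Types g F : dyadic -> R.

(** Built from the top down, so that telescoping inequalities go by induction on [d] for all [T] at
    once. *)
Fixpoint tsum (d : nat) (T : dyadic) g : R :=
  if d is e.+1 then g T + (tsum e (dleft T) g + tsum e (dright T) g) else 0.

Fixpoint tlist (d : nat) (T : dyadic) : seq dyadic :=
  if d is e.+1 then T :: tlist e (dleft T) ++ tlist e (dright T) else [::].

Lemma tsumE d T g : tsum d T g = \sum_(u <- tlist d T) g u.
Proof.
elim: d T => [|d IH] T /=; first by rewrite big_nil.
by rewrite big_cons big_cat !IH.
Qed.

Lemma tlistP d T u : u \in tlist d T <-> exists2 n, (n < d)%N & dancestor n u = T.
Proof.
elim: d T => [|d IH] T /=; first by split=> // -[].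
rewrite inE mem_cat; split=> [/or3P[/eqP->|/IH[n nd E]|/IH[n nd E]]|[[|n] nd E]].
- by exists 0%N.
- by exists n.+1; rewrite // dancestorS E dparent_left.
- by exists n.+1; rewrite // dancestorS E dparent_right.
- by apply/orP; left; rewrite -E /=.
have [e|e] := dchild_parent (dancestor n u); rewrite -dancestorS E in e;
  apply/or3P; [constructor 2|constructor 3]; by apply/IH; exists n.
Qed.

Lemma ler_sum_sub (I : eqType) (L L' : seq I) (g : I -> R) :
    (forall x, x \in L' -> 0 <= g x) -> uniq L -> {subset L <= L'} ->
  \sum_(x <- L) g x <= \sum_(x <- L') g x.
Proof.
move=> g0 uL; elim: L uL L' g0 => [|x L IH] /=.
  by move=> _ L' g0 _; rewrite big_nil big_seq sumr_ge0.
move=> /andP[xL uL] L' g0 sub.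
have xL' : x \in L' by apply: sub; rewrite inE eqxx.
rewrite big_cons (perm_big _ (perm_to_rem xL')) big_cons lerD2l; apply: IH => //.
  by move=> y /mem_rem; exact: g0.
move=> y yL; have yx : y != x by apply: contraNneq xL => <-.
by have := sub y; rewrite inE yL orbT (perm_mem (perm_to_rem xL')) inE (negbTE yx); exact.
Qed.

Lemma sum_le_tsum (L : seq dyadic) T g : (forall u, 0 <= g u) -> uniq L ->
    (forall u, u \in L -> under u T) ->
  exists d, \sum_(u <- L) g u <= tsum d T g.
Proof.
move=> g0 uL H.
have [d Hd] : exists d, {subset L <= tlist d T}.
  elim: L H {uL} => [|x L IH] H; first by exists 0%N.
  have [|d Hd] := IH; first by move=> u uL; apply: H; rewrite inE uL orbT.
  have [|n Hn] := H x; first by rewrite inE eqxx.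
  exists (maxn d n.+1) => u; rewrite inE => /predU1P[->|/Hd/tlistP[m md E]].
    by apply/tlistP; exists n; rewrite // leq_maxr.
  by apply/tlistP; exists m; rewrite // (leq_trans md) // leq_maxl.
by exists d; rewrite tsumE; apply: ler_sum_sub.
Qed.

(** The trait of [I |-> \int_I f] on which the combinatorial estimates rest; the measure and the
    integrals of the two functions become instances later. *)
Definition dadditive F := forall u, F u = F (dleft u) + F (dright u).

Lemma additive_le_parent F u : dadditive F -> (forall u, 0 <= F u) ->
  F u <= F (dparent u).
Proof.
move=> a p; rewrite [leRHS]a; case: (dchild_parent u) => <-; [rewrite lerDl|rewrite lerDr]; exact: p.
Qed.

Lemma additive_le F u v : dadditive F -> (forall u, 0 <= F u) ->
  under u v -> F u <= F v.
Proof.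
move=> a p [n <-]; elim: n => //= n IH.
by apply: le_trans IH _; exact: additive_le_parent.
Qed.

End TreeSum.

(** Stopping intervals *)

Section Stopping.
Variables (R : realFieldType) (nu F1 F2 : dyadic -> R) (r : int).

Definition avg F u := F u / nu u.

Definition bad U u := (4 * avg F1 U < avg F1 u) || (4 * avg F2 U < avg F2 u).

Definition droot (u : dyadic) : dyadic := (r, dsign u).

Fixpoint stop_rec (n : nat) (u : dyadic) : dyadic :=
  if n is m.+1 then
    let U := stop_rec m (dparent u) in if bad U u then u else U
  else droot u.

(* The smallest stopping interval above [u]; if [u] is not below a root, the
   root of its half-line. *)
Definition stop u := stop_rec (if u.1 <= r then 0%N else absz (u.1 - r)) u.

(** Removes the generation counter: later arguments use [stop] only through this recursion on the
    parent. *)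
Lemma stopE u : stop u =
  if u.1 <= r then droot u else
  if bad (stop (dparent u)) u then u else stop (dparent u).
Proof.
rewrite /stop; case: (lerP u.1 r) => // h.
have [m Em] : exists m : nat, u.1 = r + m.+1%:Z by exists (absz (u.1 - r)%R).-1; lia.
have -> : absz (u.1 - r) = m.+1 by lia.
rewrite /=; suff -> : (if (u.1 - 1 <= r)%R then 0%N else absz (u.1 - 1 - r)%R) = m by [].
by case: ifP; lia.
Qed.

Lemma droot_parent u : droot (dparent u) = droot u.
Proof. by rewrite /droot dsign_parent. Qed.

Lemma stop_droot u : stop (droot u) = droot u.
Proof.
by rewrite stopE /= lexx /droot dsign_idem.
Qed.

Lemma stop_step u : stop u = u \/ stop u = stop (dparent u).
Proof.
rewrite stopE; case: ifP => [h|_]; last by case: ifP; [left|right].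
by right; rewrite stopE ifT ?droot_parent //= lerBlDr (le_trans h) // lerDl.
Qed.

Lemma stop_ind (P : dyadic -> Prop) :
    (forall u, u.1 <= r -> P u) -> (forall u, r < u.1 -> P (dparent u) -> P u) ->
  forall u, P u.
Proof.
move=> P0 PS u; have [n] : exists n : nat, u.1 <= r + n%:Z.
  by exists (absz (u.1 - r)); lia.
elim: n u => [|n IH] u h; first by apply: P0; rewrite addr0 in h.
case: (lerP u.1 r) => [/P0//|ru]; apply: PS => //; apply: IH => /=; lia.
Qed.

Lemma stop_idem u : stop (stop u) = stop u.
Proof.
elim/stop_ind: u => [u h|u h IH]; first by rewrite [stop u]stopE h stop_droot.
by case: (stop_step u) => E; rewrite E.
Qed.

Lemma stop_under u : under u (stop u) \/ stop u = droot u.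
Proof.
elim/stop_ind: u => [u h|u h IH]; first by right; rewrite stopE h.
case: (stop_step u) => E; rewrite E; first by left; exact: under_refl.
rewrite -droot_parent; case: IH; [left|by right].
exact: under_trans (under_parent u) _.
Qed.

Lemma dsign_stop u : dsign (stop u) = dsign u.
Proof.
case: (stop_under u) => [/dsign_under//|->]; exact: dsign_idem.
Qed.

(** On the way up from [u], step [k] reaches the stopping interval of [u], and step [i] is the last
    change of stopping interval: above it the corona is already that of the endpoint. *)
Lemma stop_dichotomy n u : stop u = stop (dancestor n u) \/
  exists k i, [/\ (k <= i < n)%N, stop u = dancestor k u,
     stop (dancestor i u) = dancestor i u &
     stop (dparent (dancestor i u)) = stop (dancestor n u)].
Proof.
elim: n => [|n [E|[k [i [/andP[ki i_n] Ek Ei Es]]]]]; first by left.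
  case: (stop_step (dancestor n u)) => h; last by left; rewrite E h.
  by right; exists n, n; rewrite E h leqnn ltnSn.
right; case: (stop_step (dancestor n u)) => h.
  by exists k, n; rewrite Ek ltnSn (leq_trans ki (ltnW i_n)).
by exists k, i; rewrite Ek Ei ki (leqW i_n) Es h.
Qed.

Lemma stop_child_bad W : stop W = W -> stop (dparent W) <> W ->
  bad (stop (dparent W)) W.
Proof.
rewrite {1}stopE; case: (lerP W.1 r) => [h E|_].
  by case; rewrite -{2}E stopE ifT ?droot_parent //= lerBlDr (le_trans h) // lerDl.
by case: ifP => // _ ->.
Qed.

Hypotheses (nu_gt0 : forall u, 0 < nu u) (nuD : dadditive nu).
Hypotheses (F1_ge0 : forall u, 0 <= F1 u) (F1D : dadditive F1).
Hypotheses (F2_ge0 : forall u, 0 <= F2 u) (F2D : dadditive F2).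
Hypothesis F1_supp : forall u, u.1 <= r -> u.2 <> dsign u -> F1 u = 0.
Hypothesis F2_supp : forall u, u.1 <= r -> u.2 <> dsign u -> F2 u = 0.

(** What the estimates use of either function, so that each is proved once for both. The third
    clause places the support in the two roots; the last is the failure of the stopping
    condition. *)
Definition is_data F := [/\ forall u, 0 <= F u, dadditive F,
  forall u, u.1 <= r -> u.2 <> dsign u -> F u = 0 &
  forall U u, ~~ bad U u -> avg F u <= 4 * avg F U].

Lemma is_data1 : is_data F1.
Proof. by split=> // U u; rewrite negb_or -!leNgt => /andP[]. Qed.

Lemma is_data2 : is_data F2.
Proof. by split=> // U u; rewrite negb_or -!leNgt => /andP[]. Qed.

Lemma avgE F u : avg F u = F u / nu u.
Proof. by []. Qed.

Lemma avg_ge0 F u : is_data F -> 0 <= avg F u.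
Proof. by move=> [F0 _ _ _]; rewrite divr_ge0 // ltW. Qed.

Lemma avgK F u : avg F u * nu u = F u.
Proof. by rewrite divfK // gt_eqF. Qed.

(** Above the root level the child farther from the origin carries no integral, so climbing from the
    root adds nothing. *)
Lemma data_le_root F u : is_data F -> u.1 <= r -> F u <= F (droot u).
Proof.
move=> [F0 FD Fs _] h.
have [e|ne] := eqVneq u.2 (dsign u); last by rewrite Fs //; apply/eqP.
have e01 : u.2 = 0 \/ u.2 = -1 by rewrite e /dsign; case: ifP; [left|right].
have {e h} [n ->] : exists n : nat, u = (r - n%:Z, u.2).
  by exists (absz (r - u.1)); case: u h {e e01} => k j /= h; congr pair; lia.
have -> : droot (r - n%:Z, u.2) = (r, u.2) by case: e01 => ->.
elim: n => [|n IH]; first by rewrite subr0.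
rewrite FD; apply: le_trans IH; rewrite /dleft /dright /=.
have -> : r - n.+1%:Z + 1 = r - n%:Z by lia.
case: e01 => ->; rewrite /= ?mul0r ?add0r.
  by rewrite [F (_, 1)]Fs ?addr0 //= lerBlDr lerDl.
rewrite (_ : -1 * 2 + 1 = -1 :> int) // [F (_, -1 * 2)]Fs ?add0r //= lerBlDr lerDl //.
Qed.

Lemma nu_root_le u : u.1 <= r -> u.2 = dsign u -> nu (droot u) <= nu u.
Proof.
move=> h e; apply: additive_le => //; first by move=> v; exact: ltW.
exists (absz (r - u.1)); rewrite dancestor_dsign -e.
by case: u h {e} => k j /= h; congr pair; lia.
Qed.

(** Below the root the factor 4 is the failure of the stopping condition; above it [F] does not grow
    and [nu] does not shrink. *)
Lemma avg_le_stop F u : is_data F -> avg F u <= 4 * avg F (stop u).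
Proof.
move=> dF; have p v := avg_ge0 v dF.
have [F0 FD Fs hb] := dF; rewrite stopE; case: ifP => [h|_]; last first.
  by case: ifPn => [_|/hb//]; have := p u; lra.
have [e|ne] := eqVneq u.2 (dsign u); last first.
  by rewrite {1}/avg (Fs u h (elimN eqP ne)) mul0r mulr_ge0.
apply: (@le_trans _ _ (avg F (droot u))); last by have := p (droot u); lra.
by rewrite ler_pM ?invr_ge0 ?(ltW (nu_gt0 _)) ?data_le_root // lef_pV2 ?posrE // nu_root_le.
Qed.

(** The corona of a root also contains intervals above the root, so the common ancestor [T] may lie
    above [V]; [data_le_root] then still gives [F T <= F V]. *)
Lemma common_top (L : seq dyadic) V : (forall x, x \in L -> stop x = V) ->
  exists2 T, (forall x, x \in L -> under x T) & forall F, is_data F -> F T <= F V.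
Proof.
move=> H; have [E|E] := eqVneq V (droot V).
  have [|n Hn] := common_ancestor (L := L) r (e := dsign V).
    by move=> x /H <-; rewrite dsign_stop.
  exists (r - n%:Z, dsign V) => // F dF; rewrite [V in leRHS]E.
  have := @data_le_root F (r - n%:Z, dsign V) dF.
  by rewrite /droot dsign_idem; apply; rewrite /= lerBlDr lerDl.
exists V => // x /H xV; case: (stop_under x); rewrite xV // => e.
by case/eqP: E; rewrite e /droot dsign_idem.
Qed.

(** The stopping children of [V] form an antichain ([cP]) below a common [T], so each branch of the
    tree meets at most one of them. *)
Lemma sum_stop_children F V (L : seq dyadic) : is_data F -> uniq L ->
    (forall W, W \in L -> [/\ stop W = W, stop (dparent W) = V & W <> V]) ->
  \sum_(W <- L) F W <= F V.
Proof.
move=> dF uL HL; have [F0 FD _ _] := dF.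
have [|T HT TV] := @common_top (map dparent L) V.
  by move=> x /mapP[W /HL[_ ? _] ->].
pose c W := [&& stop W == W, stop (dparent W) == V & W != V].
have cP W W' : c W -> c W' -> under W W' -> W = W'.
  case/and3P=> /eqP sW /eqP pW _ /and3P[/eqP sW' /eqP pW' /eqP nW'].
  move=> h; apply/eqP; apply/negP => /negP/eqP ne.
  have [n En] := under_parentP h ne.
  case: (stop_dichotomy n (dparent W)); rewrite En sW' pW; first by move/esym.
  case=> k [i [/andP[ki i_n] Ek _ _]].
  (* [V] would lie strictly below [W'], although it is an ancestor of [dparent W'] or the root of
     its half-line. *)
  have lt : W'.1 < V.1 by rewrite Ek -En !dancestor1; lia.
  have := stop_under (dparent W'); rewrite pW' => -[[m Em]|EV].
    by move: lt; rewrite -Em dancestor1 /=; lia.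
  by move: lt sW'; rewrite EV stopE => /= lt; rewrite (ltW lt) => /(congr1 fst) /=; lia.
pose g W := if c W then F W else 0.
have g0 W : 0 <= g W by rewrite /g; case: ifP.
have [|d] := @sum_le_tsum _ L T g g0 uL.
  by move=> u /(map_f dparent)/HT; exact: under_trans (under_parent u).
rewrite (eq_big_seq F) => [|W /HL[sW pW /eqP VW]]; last first.
  by rewrite /g /c sW pW VW !eqxx.
move/le_trans; apply; apply: le_trans (TV F dF).
have z e U : (forall u, under u U -> ~~ c u) -> tsum e U g = 0.
  elim: e U => //= e IH U H; rewrite !IH /g ?ifN ?addr0 //.
  - by apply: H; exact: under_refl.
  - by move=> u uU; apply/H/(under_trans uU)/under_right.
  - by move=> u uU; apply/H/(under_trans uU)/under_left.
elim: d T {HT TV} => //= d IH T; rewrite {1}/g; case: ifP => [cT|_]; last first.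
  by rewrite add0r [leRHS]FD lerD.
rewrite !z ?addr0 // => u uT; apply/negP => cu.
- have e := cP _ _ cu cT (under_trans uT (under_right T)).
  by rewrite e in uT; exact: under_right_irr uT.
- have e := cP _ _ cu cT (under_trans uT (under_left T)).
  by rewrite e in uT; exact: under_left_irr uT.
Qed.

(** * Squared oscillations within one corona *)

Definition hmass J := nu (dleft J) * nu (dright J) / nu J.

Definition osc F J := avg F (dleft J) - avg F (dright J).

Lemma hmass_ge0 J : 0 <= hmass J.
Proof. by rewrite /hmass divr_ge0 ?mulr_ge0 // ltW. Qed.

(* [x ^ 2] cut off linearly above [4 l]: a convex function below [8 l x], whose
   averages telescope along the tree and gain [hmass * osc ^ 2] at each step
   that stays below [4 l]. *)
Definition cutsq (l x : R) := if x <= 4 * l then x ^+ 2 else 8 * l * x - 16 * l ^+ 2.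

Lemma cutsq_le l x : 0 <= l -> 0 <= x -> cutsq l x <= 8 * l * x.
Proof. by move=> l0 x0; rewrite /cutsq; case: (leP x (4 * l)) => h; nra. Qed.

(** [cutsq l] is the upper envelope of the tangents [2 k x - k^2] to the square with [k <= 4 l];
    [cutsq_min] says that the envelope is attained. *)
Lemma cutsq_ge l x k : k <= 4 * l -> 0 <= l -> 2 * k * x - k ^+ 2 <= cutsq l x.
Proof.
move=> kl l0; rewrite /cutsq; case: (leP x (4 * l)) => h.
  by have := sqr_ge0 (x - k); lra.
have : 0 <= (4 * l - k) * (2 * x - 4 * l - k) by apply: mulr_ge0; lra.
lra.
Qed.

Lemma cutsq_min l x : 0 <= l -> exists2 k, k <= 4 * l & cutsq l x = 2 * k * x - k ^+ 2.
Proof.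
move=> l0; rewrite /cutsq; case: (leP x (4 * l)) => h.
  by exists x => //; ring.
by exists (4 * l) => //; ring.
Qed.

(** The tangent attained at the average over [T] is affine, hence splits exactly over the children,
    where it lies below [cutsq]. *)
Lemma cutsq_convex F l T : is_data F -> 0 <= l ->
  nu T * cutsq l (avg F T) <= nu (dleft T) * cutsq l (avg F (dleft T))
    + nu (dright T) * cutsq l (avg F (dright T)).
Proof.
move=> [_ FD _ _] l0; have [k kl ->] := cutsq_min (avg F T) l0.
have e u : nu u * (2 * k * avg F u - k ^+ 2) = 2 * k * F u - nu u * k ^+ 2.
  by rewrite -[F u]avgK; ring.
have le u := ler_wpM2l (ltW (nu_gt0 u)) (cutsq_ge (avg F u) kl l0).
have := le (dleft T); have := le (dright T).
by rewrite !e (FD T) (nuD T); lra.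
Qed.

(** All three averages lie in the quadratic range, where the convexity defect is exactly the
    variance of the two child averages. *)
Lemma cutsq_gain F l T : is_data F -> avg F (dleft T) <= 4 * l ->
    avg F (dright T) <= 4 * l ->
  hmass T * osc F T ^+ 2 + nu T * cutsq l (avg F T)
    = nu (dleft T) * cutsq l (avg F (dleft T))
      + nu (dright T) * cutsq l (avg F (dright T)).
Proof.
move=> [_ FD _ _] h1 h2; rewrite /cutsq h1 h2 ifT.
  rewrite /hmass /osc /avg (FD T) (nuD T); field.
  by rewrite !gt_eqF // -?nuD.
rewrite /avg (FD T) (nuD T) ler_pdivrMr -?nuD //.
by move: h1 h2; rewrite /avg !ler_pdivrMr //; rewrite (nuD T); lra.
Qed.

Lemma stop_children_eq J V : stop (dleft J) = V -> stop (dright J) = V -> stop J = V.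
Proof.
move=> h1 h2; case: (stop_step (dleft J)); rewrite ?dparent_left h1 => // e1.
case: (stop_step (dright J)); rewrite ?dparent_right h2 => // e2.
by case: (@dleft_neq_right J); rewrite -e1 -e2.
Qed.

Lemma sum_osc_le F V (L : seq dyadic) : is_data F -> uniq L ->
    (forall J, J \in L -> stop (dleft J) = V /\ stop (dright J) = V) ->
  \sum_(J <- L) hmass J * osc F J ^+ 2 <= 8 * avg F V * F V.
Proof.
move=> dF uL HL; have [T HT TV] : exists2 T, (forall x, x \in L -> under x T) &
    forall F, is_data F -> F T <= F V.
  by apply: common_top => J /HL[]; exact: stop_children_eq.
have [F0 FD _ _] := dF; set l := avg F V; have l0 : 0 <= l := avg_ge0 V dF.
pose c J := (stop (dleft J) == V) && (stop (dright J) == V).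
pose g J := if c J then hmass J * osc F J ^+ 2 else 0.
have g0 J : 0 <= g J.
  by rewrite /g; case: ifP => // _; rewrite mulr_ge0 ?hmass_ge0 ?sqr_ge0.
have [d] := sum_le_tsum g0 uL HT.
rewrite (eq_big_seq (fun J => hmass J * osc F J ^+ 2)); last first.
  by move=> J /HL[h1 h2]; rewrite /g /c h1 h2 !eqxx.
move/le_trans; apply; apply: (@le_trans _ _ (8 * l * F T)); last first.
  by rewrite ler_wpM2l ?TV // mulr_ge0.
have base u : nu u * cutsq l (avg F u) <= 8 * l * F u.
  rewrite -[F u]avgK mulrA [leRHS]mulrC ler_wpM2l ?(ltW (nu_gt0 _)) //.
  by rewrite cutsq_le // avg_ge0.
(* The subtracted term makes the induction telescope: at an interval of the corona it grows by
   [cutsq_gain], elsewhere by [cutsq_convex]. *)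
suff : tsum d T g <= 8 * l * F T - nu T * cutsq l (avg F T).
  have : 0 <= nu T * cutsq l (avg F T); last lra.
  rewrite mulr_ge0 ?(ltW (nu_gt0 _)) //; have := @cutsq_ge l (avg F T) 0.
  by rewrite mulr0 mul0r expr0n subr0; apply=> //; exact: mulr_ge0.
elim: d T {HT TV} => [|d IH] T /=; first by rewrite subr_ge0.
have := IH (dleft T); have := IH (dright T); have := cutsq_convex T dF l0.
rewrite [F T]FD /g; case: ifP => [/andP[/eqP h1 /eqP h2]|_]; last lra.
have a1 : avg F (dleft T) <= 4 * l by rewrite /l -h1 avg_le_stop.
have a2 : avg F (dright T) <= 4 * l by rewrite /l -h2 avg_le_stop.
by have := cutsq_gain dF a1 a2; lra.
Qed.

End Stopping.

(** Pairs of intervals and the two forms *)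

(** Tree version of the index set of the cross form: for incomparable intervals, not being siblings
    means distance above 2. *)
Definition cross_pair (S : dyadic -> Prop) (N : nat) (p : dyadic * dyadic) :=
  [/\ S p.1, S p.2, ~ under p.1 p.2, ~ under p.2 p.1 &
      dparent p.1 <> dparent p.2 /\
      exists i j, (i + j <= N + 2)%N /\ dancestor i p.1 = dancestor j p.2].

Section Counting.
Variables (R : rcfType) (nu F1 F2 : dyadic -> R) (r : int) (c : R) (N : nat).
Local Notation avg := (avg nu).
Local Notation stop := (stop nu F1 F2 r).
Local Notation hmass := (hmass nu).
Local Notation osc := (osc nu).
Hypotheses (nu_gt0 : forall u, 0 < nu u) (nuD : dadditive nu).
Hypotheses (dF1 : is_data nu F1 F2 r F1) (dF2 : is_data nu F1 F2 r F2).
Hypothesis c_ge1 : 1 <= c.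
Hypothesis hmass_balanced : forall I,
  c^-1 * hmass (dparent I) <= hmass I <= c * hmass (dparent I).

Let avg0 F u (dF : is_data nu F1 F2 r F) : 0 <= avg F u := avg_ge0 nu_gt0 u dF.
Let F0 F u (dF : is_data nu F1 F2 r F) : 0 <= F u.
Proof. by case: dF. Qed.
Let FD F (dF : is_data nu F1 F2 r F) : dadditive F.
Proof. by case: dF. Qed.
Let c_gt0 : 0 < c. Proof. exact: lt_le_trans c_ge1. Qed.
Let m0 u : 0 <= hmass u := hmass_ge0 nu_gt0 u.

Let K := c ^+ (N + 2).

Lemma K_ge1 : 1 <= K. Proof. exact: exprn_ege1. Qed.

Lemma hmass_le_nu u : hmass u <= nu u.
Proof.
rewrite /hmass ler_pdivrMr // (nuD u).
have := nu_gt0 (dleft u); have := nu_gt0 (dright u); nra.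
Qed.

Lemma hmass_dancestor n u : hmass (dancestor n u) <= c ^+ n * hmass u.
Proof.
elim: n => [|n IH]; first by rewrite mul1r.
have /andP[h _] := hmass_balanced (dancestor n u).
rewrite exprS -mulrA -ler_pdivrMl // (le_trans h) //.
Qed.

Lemma hmass_descendant n u : hmass u <= c ^+ n * hmass (dancestor n u).
Proof.
elim: n => [|n IH]; first by rewrite mul1r.
have /andP[_ h] := hmass_balanced (dancestor n u).
by rewrite (le_trans IH) // exprSr -mulrA ler_wpM2l // exprn_ge0 // ltW.
Qed.

Lemma hmass_le n u I : dancestor n u = I -> (n <= N + 2)%N -> hmass I <= K * hmass u.
Proof.
move=> <- nN; apply: le_trans (hmass_dancestor n u) _.
by rewrite ler_wpM2r // ler_weXn2l.
Qed.

(** The mass of [I] is at most [K] times that of [u], hence at most [K * nu u]; an average thus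
    becomes an integral. *)
Lemma hmass_avg_le F n u I : is_data nu F1 F2 r F -> dancestor n u = I ->
  (n <= N + 2)%N -> hmass I * avg F u <= K * F u.
Proof.
move=> dF E nN; have h : hmass I <= K * nu u.
  apply: le_trans (hmass_le E nN) _.
  by rewrite ler_wpM2l ?hmass_le_nu // (le_trans ler01) // K_ge1.
by rewrite -(avgK nu_gt0 F u) [avg F u * nu u]mulrC [leRHS]mulrA ler_wpM2r ?avg0.
Qed.

(** The four products of data of [W] and of the stopping interval above its parent that occur in
    [near_stop]; all of them sum to the sparse form. *)
Definition stop_weight W : R :=
  let V := stop (dparent W) in
  avg F1 W * F2 W + avg F1 V * avg F2 V * nu W + F1 W * avg F2 V + avg F1 V * F2 W.

Definition cross_weight (p : dyadic * dyadic) : R :=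
  avg F1 p.1 * avg F2 p.2 * Num.sqrt (hmass p.1) * Num.sqrt (hmass p.2).

Definition stops W := stop W = W.

(** A single weight is charged, at most [N + 2] generations below [I]; thus each interval is charged
    from at most [N + 3] places. *)
Definition near_ok I (x : R) :=
  (exists W j, [/\ stops W, (j <= N + 2)%N, dancestor j W = I & x <= stop_weight W]) \/
  (exists p j, [/\ cross_pair stops N p, (j <= N + 2)%N, dancestor j p.1 = I &
                   x <= cross_weight p]).

Lemma near_ok_le I x y : x <= y -> near_ok I y -> near_ok I x.
Proof.
move=> xy [[W [j [h1 h2 h3 h4]]]|[p [j [h1 h2 h3 h4]]]]; [left; exists W, j|right; exists p, j];
  by split=> //; exact: le_trans h4.
Qed.

Lemma stop_weight_ge W :
  [/\ avg F1 W * F2 W <= stop_weight W,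
      avg F1 (stop (dparent W)) * avg F2 (stop (dparent W)) * nu W <= stop_weight W,
      F1 W * avg F2 (stop (dparent W)) <= stop_weight W &
      avg F1 (stop (dparent W)) * F2 W <= stop_weight W].
Proof.
rewrite /stop_weight /=; set V := stop (dparent W).
have p1 : 0 <= avg F1 W * F2 W by rewrite mulr_ge0 ?avg0 ?F0.
have p2 : 0 <= avg F1 V * avg F2 V * nu W by rewrite mulr_ge0 ?(ltW (nu_gt0 _)) // mulr_ge0 ?avg0.
have p3 : 0 <= F1 W * avg F2 V by rewrite mulr_ge0 ?avg0 ?F0.
have p4 : 0 <= avg F1 V * F2 W by rewrite mulr_ge0 ?avg0 ?F0.
by split; lra.
Qed.

Lemma stop_weight_ge0 W : 0 <= stop_weight W.
Proof.
by have [h _ _ _] := stop_weight_ge W; apply: le_trans h; rewrite mulr_ge0 ?avg0 ?F0.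
Qed.

Lemma cross_weight_ge0 p : 0 <= cross_weight p.
Proof.
rewrite /cross_weight mulr_ge0 ?sqrtr_ge0 // mulr_ge0 ?sqrtr_ge0 //.
by rewrite mulr_ge0 ?avg0.
Qed.

Let le_mono F u v (dF : is_data nu F1 F2 r F) : under u v -> F u <= F v.
Proof. by apply: additive_le; [exact: FD|move=> w; exact: F0]. Qed.

(** An interval with at least half of its parent's measure has at most twice the parent's
    average. *)
Lemma sibling_avg F u : is_data nu F1 F2 r F -> nu (dparent u) <= 2 * nu u ->
  avg F u <= 8 * avg F (stop (dparent u)).
Proof.
move=> dF h; apply: (@le_trans _ _ (2 * avg F (dparent u))); last first.
  have := avg_le_stop nu_gt0 nuD (dparent u) dF; lra.
rewrite ler_pdivrMr //; apply: le_trans (le_mono dF (under_parent u)) _.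
by have := ler_wpM2l (avg0 (dparent u) dF) h; rewrite avgK //; lra.
Qed.

Let stop_dist a u I : dancestor a u = I ->
  stop u = stop I \/ exists k i, [/\ (k <= i < a)%N /\ stop u = dancestor k u,
    stops (dancestor i u), dancestor (a - i) (dancestor i u) = I,
    dancestor (a - k) (stop u) = I &
    stop (dparent (dancestor i u)) = stop I].
Proof.
move=> E; have := stop_dichotomy nu F1 F2 r a u; rewrite E => -[|[k [i [ki Ek Ei Es]]]].
  by left.
have /andP[h1 h2] := ki.
right; exists k, i; split=> //.
  by rewrite -dancestorD subnK // ltnW.
by rewrite Ek -dancestorD subnK // ltnW // (leq_ltn_trans h1).
Qed.

(** Here [u] and [v] are halves of two Haar intervals below [I], and [x], possibly a third half, is
    where the stopping interval changes. The cases are the relative positions of [stop u], [stop v]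
    and [I]. *)
Lemma near_stop a b e u v x I :
    dancestor a u = I -> dancestor b v = I -> dancestor e x = I ->
    (0 < a)%N -> (0 < b)%N -> (a + b <= N + 2)%N -> (e <= N + 2)%N -> stop x <> stop I ->
  near_ok I (hmass I * avg F1 (stop u) * avg F2 (stop v) / (8 * K)).
Proof.
move=> Eu Ev Ex a0 b0 abN eN neq.
have K1 := K_ge1; have K0 : 0 < K := lt_le_trans ltr01 K1.
have K80 : 0 < 8 * K by rewrite mulr_gt0.
have ok W j y : stops W -> (j <= N + 2)%N -> dancestor j W = I ->
    y <= 8 * K * stop_weight W -> near_ok I (y / (8 * K)).
  by move=> *; left; exists W, j; split; rewrite // ler_pdivrMr // mulrC.
have ok1 W j y : stops W -> (j <= N + 2)%N -> dancestor j W = I ->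
    y <= K * stop_weight W -> near_ok I (y / (8 * K)).
  move=> h1 h2 h3 h4; apply: ok h1 h2 h3 (le_trans h4 _).
  by rewrite ler_wpM2r ?stop_weight_ge0 //; lra.
have KM y y' z : y <= K * y' -> 0 <= z -> y * z <= K * (y' * z).
  by move=> h z0; rewrite mulrA ler_wpM2r.
case: (stop_dist Eu) => [EU|[k [i [[/andP[ki ia] EU] sW EW Uk pW]]]];
  case: (stop_dist Ev) => [EV|[l [j [[/andP[lj jb] EV] sX EX Vl pX]]]].
(* Both averages are taken over [stop I], so the charged interval comes from the way up from [x] to
   [I]. *)
- case: (stop_dist Ex) => // -[k [i [[/andP[ki ie] EU'] sW EW Uk pW]]].
  rewrite EU EV -pW; apply: (ok1 (dancestor i x) (e - i)%N) => //; first lia.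
  have [_ h _ _] := stop_weight_ge (dancestor i x).
  apply: le_trans (ler_wpM2l (ltW K0) h).
  rewrite -mulrA mulrC [leRHS]mulrCA; apply: ler_wpM2l; first by rewrite mulr_ge0 ?avg0.
  have /(_ _)/le_trans := hmass_le EW; apply; first lia.
  by rewrite ler_wpM2l ?hmass_le_nu // ltW.
(* Only [stop v] is known to lie strictly below [I]. The topmost stopping interval on that path
   contains it, and the stopping interval of its parent is [stop I]. The next case is symmetric. *)
- rewrite EU -pX; apply: (ok1 (dancestor j v) (b - j)%N) => //; first lia.
  have [_ _ _ h] := stop_weight_ge (dancestor j v).
  apply: le_trans (ler_wpM2l (ltW K0) h); rewrite mulrAC [avg F1 _ * F2 _]mulrC.
  apply: KM; last exact: avg0.
  apply: le_trans (hmass_avg_le dF2 Vl _) _; first lia.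
  rewrite ler_wpM2l ?(ltW K0) // le_mono // EV; exists (j - l)%N.
  by rewrite -dancestorD subnK.
- rewrite EV -pW; apply: (ok1 (dancestor i u) (a - i)%N) => //; first lia.
  have [_ _ h _] := stop_weight_ge (dancestor i u).
  apply: le_trans (ler_wpM2l (ltW K0) h).
  apply: KM; last exact: avg0.
  apply: le_trans (hmass_avg_le dF1 Uk _) _; first lia.
  rewrite ler_wpM2l ?(ltW K0) // le_mono // EU; exists (i - k)%N.
  by rewrite -dancestorD subnK.
(* Both stopping intervals lie strictly below [I]; from here on only they and their distances to [I]
   matter. *)
have sU : stops (stop u) by exact: stop_idem.
have sV : stops (stop v) by exact: stop_idem.
have a'N : (a - k <= N + 2)%N by lia.
have b'N : (b - l <= N + 2)%N by lia.
have abN' : ((a - k) + (b - l) <= N + 2)%N by lia.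
move: (stop u) (stop v) (a - k)%N (b - l)%N sU sV Uk Vl a'N b'N abN'.
move=> U V a' b' {u v a b k l i j Eu Ev a0 b0 abN ki ia EU sW EW pW lj jb EV sX EX pX}.
move=> sU sV EU EV aN bN abN.
have [[p UV]|nUV] := pselect (under U V).
  have [e0 _] : stop U = U /\ stop V = V by [].
  have [UeV|nUeV] := eqVneq U V.
    apply: (ok1 U a') => //; have [h _ _ _] := stop_weight_ge U.
    apply: le_trans (ler_wpM2l (ltW K0) h).
    rewrite -UeV mulrAC [avg F1 U * _]mulrC.
    by apply: KM; [exact: hmass_avg_le EU _|exact: avg0].
  (* For [U] strictly inside [V], the charged interval is the topmost stopping interval below [V] on
     the way to [U]. *)
  have := stop_dist UV; rewrite sU sV => -[/eqP|[k [i [[/andP[ki ip] _] sW EW _ pW]]]].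
    by rewrite (negbTE nUeV).
  have ea : a' = (b' + p)%N.
    by apply: (@dancestor_inj _ _ U); rewrite EU -EV -UV dancestorD.
  apply: (ok1 (dancestor i U) (a' - i)%N) => //; first lia.
    by rewrite -dancestorD subnK //; lia.
  have [_ _ h _] := stop_weight_ge (dancestor i U); rewrite pW in h.
  apply: le_trans (ler_wpM2l (ltW K0) h).
  apply: KM; last exact: avg0.
  apply: le_trans (hmass_avg_le dF1 EU _) _ => //.
  by rewrite ler_wpM2l ?(ltW K0) // le_mono //; exists i.
have [[p VU]|nVU] := pselect (under V U).
  have := stop_dist VU; rewrite sU sV => -[VeU|[k [i [[/andP[ki ip] _] sW EW _ pW]]]].
    by case: nUV; rewrite VeU; exact: under_refl.
  have eb : b' = (a' + p)%N.
    by apply: (@dancestor_inj _ _ V); rewrite EV -EU -VU dancestorD.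
  apply: (ok1 (dancestor i V) (b' - i)%N) => //; first lia.
    by rewrite -dancestorD subnK //; lia.
  have [_ _ _ h] := stop_weight_ge (dancestor i V); rewrite pW in h.
  apply: le_trans (ler_wpM2l (ltW K0) h); rewrite mulrAC [avg F1 _ * F2 _]mulrC.
  apply: KM; last exact: avg0.
  apply: le_trans (hmass_avg_le dF2 EV _) _ => //.
  by rewrite ler_wpM2l ?(ltW K0) // le_mono //; exists i.
(* Siblings have distance 2 and form no cross pair. The average over the larger one passes to the
   stopping interval above the parent, and the smaller one is charged. *)
have [Pe|Pne] := eqVneq (dparent U) (dparent V).
  have nuP : nu (dparent U) = nu U + nu V.
    rewrite nuD; have [EU'|EU'] := dchild_parent U; have [EV'|EV'] := dchild_parent V;
      rewrite -Pe in EV'.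
    - by case: nUV; exists 0%N; rewrite EU' EV'.
    - by rewrite -EU' -EV'.
    - by rewrite -EU' -EV' addrC.
    - by case: nUV; exists 0%N; rewrite EU' EV'.
  have [UV|VU] := lerP (nu U) (nu V).
    apply: (ok U a') => //; have [_ _ h _] := stop_weight_ge U.
    have h2 : nu (dparent V) <= 2 * nu V by rewrite -Pe nuP; lra.
    have := sibling_avg dF2 h2; rewrite -Pe => h3.
    have := hmass_avg_le dF1 EU aN => h1.
    apply: le_trans (ler_wpM2l (ltW K80) h).
    apply: le_trans (ler_pM _ (avg0 V dF2) h1 h3) _; first by rewrite mulr_ge0 ?avg0.
    by rewrite [leRHS]mulrA [8 * K * _]mulrAC -!mulrA; lra.
  apply: (ok V b') => //; have [_ _ _ h] := stop_weight_ge V.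
  have h2 : nu (dparent U) <= 2 * nu U by rewrite nuP; lra.
  have := sibling_avg dF1 h2; rewrite Pe => h3.
  have := hmass_avg_le dF2 EV bN => h1.
  apply: le_trans (ler_wpM2l (ltW K80) h).
  rewrite mulrAC; apply: le_trans (ler_pM _ (avg0 U dF1) h1 h3) _.
    by rewrite mulr_ge0 ?avg0.
  by rewrite le_eqVlt; apply/orP; left; apply/eqP; ring.
right; exists (U, V), a'; split=> //.
  split=> //=; split; first exact/eqP.
  by exists a', b'; rewrite EU EV.
rewrite ler_pdivrMr // /cross_weight /=.
have s0 := sqrtr_ge0.
(* The geometric mean of the mass bounds for [U] and [V]. *)
have h : hmass I <= K * (Num.sqrt (hmass U) * Num.sqrt (hmass V)).
  rewrite -[hmass I]sqr_sqrtr // expr2 -[K]sqr_sqrtr ?(ltW K0) // expr2 mulrACA.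
  by rewrite ler_pM // -sqrtrM ?(ltW K0) // ler_wsqrtr // (hmass_le EU, hmass_le EV).
have A0 : 0 <= avg F1 U * avg F2 V by rewrite mulr_ge0 ?avg0.
have := ler_wpM2r A0 h.
have : 0 <= K * (Num.sqrt (hmass U) * Num.sqrt (hmass V)) * (avg F1 U * avg F2 V).
  by rewrite mulr_ge0 // mulr_ge0 ?(ltW K0) // mulr_ge0.
rewrite mulrA; move: (hmass I) (avg F1 U) (avg F2 V) (Num.sqrt _) (Num.sqrt _) K => *; lra.
Qed.

End Counting.

Lemma sum_fiber (R : realFieldType) (I J : eqType) (L : seq I) (h : I -> J) (f : I -> R) :
  \sum_(x <- L) f x = \sum_(y <- undup (map h L)) \sum_(x <- L | h x == y) f x.
Proof.
under [RHS]eq_bigr do rewrite big_mkcond.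
rewrite exchange_big /=; apply: eq_big_seq => x xL.
rewrite (bigD1_seq (h x)) /= ?undup_uniq ?mem_undup ?map_f // eqxx big1 ?addr0 //.
by move=> y; rewrite eq_sym => /negbTE ->.
Qed.

Lemma sum_dlist_flatten (R : realFieldType) n (L : seq dyadic) (f : dyadic -> R) :
  \sum_(x <- L) \sum_(J <- dlist n x) f J = \sum_(J <- flatten [seq dlist n x | x <- L]) f J.
Proof. by rewrite big_flatten big_map. Qed.

(* 4 choices of one half of J and one of K, two factors 4 from [avg_le_stop],
   and the factor 8 K of [near_stop], where a further K bounds the masses of
   J and K by that of their common ancestor. *)
Definition near_const (R : realFieldType) (K : R) : R := 512%:R * K ^+ 2.

Lemma near_const_gt0 (R : realFieldType) (K : R) : 0 < K -> 0 < near_const K.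
Proof. by move=> K0; rewrite pmulr_rgt0 ?ltr0n // exprn_gt0. Qed.

(** A maximum is taken because [near_ok] charges one weight: the largest of the four products is at
    least a quarter of their sum. *)
Lemma max4_ge (R : realFieldType) (m a b p q K : R) : 0 <= m -> 1 <= K ->
    0 <= a -> 0 <= b -> 0 <= p -> 0 <= q ->
  K * m * ((4 * a + 4 * b) * (4 * p + 4 * q)) / near_const K <=
  Num.max (Num.max (m * a * p / (8 * K)) (m * a * q / (8 * K)))
          (Num.max (m * b * p / (8 * K)) (m * b * q / (8 * K))).
Proof.
move=> m0 K1 a0 b0 p0 q0; have K0 : 0 < K := lt_le_trans ltr01 K1.
have [x Ex] : exists x, x = m / (8 * K) by eexists.
have e y z : m * y * z / (8 * K) = x * (y * z) by rewrite Ex; ring.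
rewrite !e; set M := Num.max _ _.
have [h1 h2 h3 h4] : [/\ x * (a * p) <= M, x * (a * q) <= M, x * (b * p) <= M & x * (b * q) <= M].
  by split; rewrite /M !le_max lexx ?orbT.
rewrite (_ : _ / _ = (x * (a * p) + x * (a * q) + x * (b * p) + x * (b * q)) / 4); first by lra.
by rewrite Ex /near_const; field; rewrite gt_eqF.
Qed.

(** The vanishing hypotheses cover a zero weight, where the quotients take the default value 0. *)
Lemma weighted_amgm (R : realFieldType) (p q a b : R) : 0 <= p -> 0 <= q ->
    (p = 0 -> a = 0) -> (q = 0 -> b = 0) ->
  a * b <= (q / p * a ^+ 2 + p / q * b ^+ 2) / 2.
Proof.
move=> p0 q0 pa qb; have [pz|pn] := eqVneq p 0.
  by rewrite (pa pz) pz expr0n !(mul0r, mulr0, addr0).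
have [qz|qn] := eqVneq q 0.
  by rewrite (qb qz) qz expr0n !(mul0r, mulr0, addr0).
have pp : 0 < p by rewrite lt0r pn.
have qp : 0 < q by rewrite lt0r qn.
rewrite -subr_ge0 (_ : _ - _ = (q * a - p * b) ^+ 2 / (2 * p * q)); last first.
  by field; rewrite pn qn.
by rewrite divr_ge0 ?sqr_ge0 // !mulr_ge0.
Qed.

(** * Haar coefficients and their sums over finite families *)

Section Sums.
Variables (R : rcfType) (nu F1 F2 : dyadic -> R) (r : int) (c : R) (N : nat).
Local Notation avg := (avg nu).
Local Notation stop := (stop nu F1 F2 r).
Local Notation hmass := (hmass nu).
Local Notation osc := (osc nu).
Local Notation is_data := (is_data nu F1 F2 r).
Local Notation stops := (stops nu F1 F2 r).
Local Notation stop_weight := (stop_weight nu F1 F2 r).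
Local Notation cross_weight := (cross_weight nu F1 F2).
Local Notation near_ok := (near_ok nu F1 F2 r N).
Hypotheses (nu_gt0 : forall u, 0 < nu u) (nuD : dadditive nu).
Hypotheses (dF1 : is_data F1) (dF2 : is_data F2).
Hypothesis c_ge1 : 1 <= c.
Hypothesis hmass_balanced : forall I,
  c^-1 * hmass (dparent I) <= hmass I <= c * hmass (dparent I).

Let avg0 F u (dF : is_data F) : 0 <= avg F u := avg_ge0 nu_gt0 u dF.
Let F0 F u (dF : is_data F) : 0 <= F u.
Proof. by case: dF. Qed.
Let m0 u : 0 <= hmass u := hmass_ge0 nu_gt0 u.
Let K := c ^+ (N + 2).
Let K1 : 1 <= K := K_ge1 N c_ge1.

Let near_ok_max I (x y : R) : near_ok I x -> near_ok I y -> near_ok I (Num.max x y).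
Proof. by case: leP. Qed.

(** The absolute value of the Haar coefficient, as [pairing_haar] shows. *)
Definition haar_coef F J := Num.sqrt (hmass J) * `|osc F J|.

Lemma haar_coef_ge0 F J : 0 <= haar_coef F J.
Proof. by rewrite mulr_ge0 ?sqrtr_ge0. Qed.

Lemma haar_coef_le F J : is_data F ->
  haar_coef F J <= Num.sqrt (hmass J) *
    (4 * avg F (stop (dleft J)) + 4 * avg F (stop (dright J))).
Proof.
move=> dF; rewrite ler_wpM2l ?sqrtr_ge0 //; apply: le_trans (ler_normB _ _) _.
by rewrite !ger0_norm ?avg0 // lerD // avg_le_stop.
Qed.

(** Both coefficients are bounded by averages over the stopping intervals of the halves and by the
    mass of [I]; expanding gives four products for [near_stop]. *)
Lemma haar_coef_near s t I J J' x : (s + t <= N)%N ->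
    dancestor s J = I -> dancestor t J' = I ->
    x \in [:: dleft J; dright J; dleft J'; dright J'] -> stop x <> stop I ->
  near_ok I (haar_coef F1 J * haar_coef F2 J' / near_const K).
Proof.
move=> stN EJ EJ' xin xI.
have [e eN Ex] : exists2 e, (e <= N + 2)%N & dancestor e x = I.
  move: xin; rewrite !inE => /or4P[]/eqP->; [exists s.+1|exists s.+1|exists t.+1|exists t.+1];
   rewrite ?dancestorSr ?dparent_left ?dparent_right //; lia.
(* Passing to halves adds one generation on each side, whence [N + 2]. *)
have nr u v : dparent u = J -> dparent v = J' ->
    near_ok I (hmass I * avg F1 (stop u) * avg F2 (stop v) / (8 * K)).
  move=> Eu Ev; apply: (@near_stop _ _ _ _ _ _ _ nu_gt0 nuD dF1 dF2 c_ge1 hmass_balanced s.+1 t.+1 e u v x) => //; try lia.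
  - by rewrite dancestorSr Eu.
  - by rewrite dancestorSr Ev.
have n1 := nr _ _ (dparent_left J) (dparent_left J').
have n2 := nr _ _ (dparent_left J) (dparent_right J').
have n3 := nr _ _ (dparent_right J) (dparent_left J').
have n4 := nr _ _ (dparent_right J) (dparent_right J').
have {n1 n2 n3 n4} := near_ok_max (near_ok_max n1 n2) (near_ok_max n3 n4).
apply: near_ok_le; apply: le_trans (max4_ge (m0 I) K1 _ _ _ _); try exact: avg0.
have K0 : 0 < K := lt_le_trans ltr01 K1.
have D0 := near_const_gt0 K0.
rewrite ler_pM2r ?invr_gt0 //.
have hm u n : dancestor n u = I -> (n <= N)%N -> Num.sqrt (hmass u) <= Num.sqrt (K * hmass I).
  move=> <- nN; rewrite ler_wsqrtr // (le_trans (hmass_descendant c_ge1 hmass_balanced n u)) //.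
  by rewrite ler_wpM2r // /K ler_weXn2l //; lia.
have hJ : Num.sqrt (hmass J) <= Num.sqrt (K * hmass I) by apply: hm EJ _; lia.
have hJ' : Num.sqrt (hmass J') <= Num.sqrt (K * hmass I) by apply: hm EJ' _; lia.
have ss := ler_pM (sqrtr_ge0 _) (sqrtr_ge0 _) hJ hJ'.
rewrite -expr2 (sqr_sqrtr (mulr_ge0 (ltW K0) (m0 I))) in ss.
have := ler_pM (haar_coef_ge0 _ _) (haar_coef_ge0 _ _) (haar_coef_le J dF1) (haar_coef_le J' dF2).
move/le_trans; apply; rewrite mulrACA ler_wpM2r //.
by rewrite mulr_ge0 // addr_ge0 // mulr_ge0 ?avg0.
Qed.


(** A finite enumeration of the cross partners of [U], found by going up and then down at most
    [N + 2] generations each. *)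
Definition crosslist (U : dyadic) : seq dyadic :=
  undup [seq V <- flatten [seq dlist k (dancestor i U) | i <- iota 0 N.+3, k <- iota 0 N.+3]
        | `[< cross_pair stops N (U, V) >]].

Definition stop_part W := if stop W == W then stop_weight W else 0.

(** Contains every weight that [near_ok] may charge at [I], so that summation over [I] needs no
    choice. *)
Definition near_sum I := \sum_(j <- iota 0 N.+3) \sum_(W <- dlist j I)
  (stop_part W + \sum_(V <- crosslist W) cross_weight (W, V)).

Lemma mem_crosslist p : p.2 \in crosslist p.1 <-> cross_pair stops N p.
Proof.
rewrite mem_undup mem_filter; split=> [/andP[/asboolP]|h]; first by case: p.
apply/andP; split; first by apply/asboolP; case: p h.
have [_ _ _ _ [_ [i [k [ik E]]]]] := h.
apply/flattenP; exists (dlist k (dancestor i p.1)); last by rewrite mem_dlist E.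
by apply/allpairsP; exists (i, k); rewrite !mem_iota /=; split=> //; lia.
Qed.

Lemma stop_part_ge0 W : 0 <= stop_part W.
Proof. by rewrite /stop_part; case: ifP => // _; exact: stop_weight_ge0. Qed.

Let cross0 p : 0 <= cross_weight p := cross_weight_ge0 nu_gt0 dF1 dF2 p.

Lemma near_sum_part_ge0 W :
  0 <= stop_part W + \sum_(V <- crosslist W) cross_weight (W, V).
Proof. by rewrite addr_ge0 ?stop_part_ge0 ?sumr_ge0. Qed.

Lemma le_sum_seq (I : eqType) (L : seq I) x (f : I -> R) :
  (forall y, 0 <= f y) -> x \in L -> f x <= \sum_(y <- L) f y.
Proof.
move=> f0 xL; rewrite (perm_big _ (perm_to_rem xL)) big_cons lerDl.
exact: sumr_ge0.
Qed.

Lemma near_sum_ge0 I : 0 <= near_sum I.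
Proof. by do 2 (apply: sumr_ge0 => ? _); exact: near_sum_part_ge0. Qed.

Lemma near_ok_sum I x : near_ok I x -> x <= near_sum I.
Proof.
have h j W : (j <= N + 2)%N -> dancestor j W = I ->
    stop_part W + \sum_(V <- crosslist W) cross_weight (W, V) <= near_sum I.
  move=> jN E; have jL : j \in iota 0 N.+3 by rewrite mem_iota; lia.
  have WL : W \in dlist j I by rewrite mem_dlist E.
  apply: le_trans (le_sum_seq _ jL); last first.
    by move=> i; apply: sumr_ge0 => ? _; exact: near_sum_part_ge0.
  exact: (le_sum_seq near_sum_part_ge0 WL).
case=> [[W [j [sW jN E xW]]]|[p [j [cp jN E xp]]]].
  apply: le_trans (h j W jN E); rewrite /stop_part sW eqxx; apply: le_trans xW _.
  by rewrite lerDl sumr_ge0.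
apply: le_trans (h j p.1 jN E); apply: le_trans xp _.
apply: (@le_trans _ _ (\sum_(V <- crosslist p.1) cross_weight (p.1, V))).
  case: p cp {E} => U V /mem_crosslist /= VL.
  exact: (@le_sum_seq _ _ V (fun V => cross_weight (U, V))).
by rewrite lerDr stop_part_ge0.
Qed.

Definition stop_child V W := [/\ stop W = W, stop (dparent W) = V & W <> V].

(** A Chebyshev bound: each such [W] carries more than [4 * avg F V * nu W] of an integral whose
    total is at most [F V]. *)
Lemma sum_child_nu_part F V (M : seq dyadic) : is_data F -> uniq M ->
    (forall W, W \in M -> stop_child V W /\ 4 * avg F V < avg F W) ->
  4 * \sum_(W <- M) nu W <= nu V.
Proof.
move=> dF uM HM; have FM : \sum_(W <- M) F W <= F V.
  by apply: (sum_stop_children dF uM) => W /HM[].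
have nF W : W \in M -> 4 * avg F V * nu W <= F W.
  by move=> /HM[_ /ltW h]; rewrite -(avgK nu_gt0 F W) ler_wpM2r // ltW.
(* If [F V = 0] there can be no such child, since its average would be positive. *)
have [F_eq0|F_gt0] := eqVneq (F V) 0.
  case: M uM HM FM {nF} => [|W M] _ HM FM; first by rewrite big_nil mulr0 ltW.
  have [_ h] := HM W (mem_head _ _).
  have : 0 < avg F W by apply: le_lt_trans h; rewrite mulr_ge0 ?avg0.
  rewrite avgE pmulr_lgt0 ?invr_gt0 //; move: FM; rewrite big_cons F_eq0.
  have : 0 <= \sum_(j <- M) F j by apply: sumr_ge0 => ? _; exact: F0.
  by move=> *; lra.
have l0 : 0 < avg F V by rewrite divr_gt0 // lt0r F_gt0 F0.
rewrite -(ler_pM2l l0) [leRHS]mulrC -/(_ * _) mulrA [avg F V * 4]mulrC.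
rewrite [nu V * _]mulrC (avgK nu_gt0) mulr_sumr (le_trans _ FM) // !big_seq.
by apply: ler_sum => W; exact: nF.
Qed.

(** Each stopping child is caused by [F1] or by [F2], and each cause accounts for at most a quarter
    of [nu V]. *)
Lemma sum_child_nu V (M : seq dyadic) : uniq M ->
  (forall W, W \in M -> stop_child V W) -> 2 * \sum_(W <- M) nu W <= nu V.
Proof.
move=> uM HM; rewrite (bigID (fun W => 4 * avg F1 V < avg F1 W)) /=.
rewrite -big_filter -[X in _ + X]big_filter.
set M1 := seq.filter _ _; set M2 := seq.filter _ _.
have h1 : 4 * \sum_(W <- M1) nu W <= nu V.
  apply: (sum_child_nu_part dF1) => [|W]; first exact: filter_uniq.
  by rewrite mem_filter => /andP[? /HM].
have h2 : 4 * \sum_(W <- M2) nu W <= nu V.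
  apply: (sum_child_nu_part dF2) => [|W]; first exact: filter_uniq.
  rewrite mem_filter => /andP[n1 /HM cW]; split=> //.
  have [sW pW nW] := cW.
  have := @stop_child_bad _ nu F1 F2 r W sW; rewrite pW => /(_ (nesym nW)).
  by rewrite /bad (negbTE n1).
by lra.
Qed.

(** * Estimates from a bound [B] on the finite partial sums of both forms *)

Section Bound.
Variable B : R.
Hypothesis stop_bound : forall L : seq dyadic, uniq L ->
  (forall W, W \in L -> stops W) -> \sum_(W <- L) avg F1 W * F2 W <= B.
Hypothesis cross_bound : forall L : seq (dyadic * dyadic), uniq L ->
  (forall p, p \in L -> cross_pair stops N p) -> \sum_(p <- L) cross_weight p <= B.

Let avgF u : avg F1 u * F2 u = F1 u * avg F2 u.
Proof. by rewrite !avgE mulrAC mulrA. Qed.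

Lemma B_ge0 : 0 <= B.
Proof. by have := @stop_bound [::] isT; rewrite big_nil; apply. Qed.

(** The intervals are grouped by the stopping interval [V] above their parents; a group consists of
    stopping children of [V] and, when [V] is a root, possibly [V] itself, whence the factor 2. *)
Lemma sum_stop_fiber F (x : dyadic -> R) (L : seq dyadic) : (forall V, 0 <= x V) ->
    (forall V, stops V -> x V * F V <= avg F1 V * F2 V) ->
    uniq L -> (forall W, W \in L -> stops W) ->
    (forall V (M : seq dyadic), uniq M ->
       (forall W, W \in M -> stop_child V W) -> \sum_(W <- M) F W <= F V) -> (forall V, 0 <= F V) ->
  \sum_(W <- L) x (stop (dparent W)) * F W <= 2 * B.
Proof.
move=> x0 xF uL sL FM F_ge0; rewrite (sum_fiber _ (fun W => stop (dparent W))).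
set Vs := undup _; have uV : uniq Vs := undup_uniq _.
have sV V : V \in Vs -> stops V.
  by rewrite mem_undup => /mapP[W _ ->]; exact: stop_idem.
apply: (@le_trans _ _ (\sum_(V <- Vs) 2 * (avg F1 V * F2 V))); last first.
  by rewrite -mulr_sumr ler_wpM2l // stop_bound.
rewrite !big_seq; apply: ler_sum => V VV.
rewrite (eq_bigr (fun W => x V * F W)) => [|W /eqP -> //].
rewrite -mulr_sumr -big_filter.
have FV2 : \sum_(W <- [seq W <- L | stop (dparent W) == V]) F W <= 2 * F V.
  rewrite (bigID (pred1 V)) /= (_ : 2 * F V = F V + F V) ?lerD //; last by ring.
    rewrite -big_filter; set M := seq.filter _ _.
    have : M = [::] \/ M = [:: V].
      have : uniq M by rewrite !filter_uniq.
      have : all (pred1 V) M by exact: filter_all.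
      case: M => [|a [|b M]]; [by left|by rewrite /= andbT => /eqP->; right|].
      by rewrite /= => /and3P[/eqP-> /eqP-> _]; rewrite inE eqxx.
    by case=> ->; rewrite ?big_nil ?big_seq1.
  rewrite -big_filter; apply: FM; first by rewrite !filter_uniq.
  by move=> W; rewrite !mem_filter => /and3P[/eqP WV /eqP e WL]; split=> //; exact: sL.
apply: le_trans (ler_wpM2l (x0 V) FV2) _.
by rewrite mulrCA ler_wpM2l // xF //; exact: sV.
Qed.

(** The first product gives [B], each of the three involving the interval above the parent gives
    [2 * B]. *)
Lemma sum_stop_weight (L : seq dyadic) : uniq L -> (forall W, W \in L -> stops W) ->
  \sum_(W <- L) stop_weight W <= 7 * B.
Proof.
move=> uL sL; rewrite !big_split /=.
have h0 := stop_bound uL sL.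
have child F V (M : seq dyadic) : is_data F -> uniq M ->
    (forall W, W \in M -> stop_child V W) -> \sum_(W <- M) F W <= F V.
  by move=> dF uM HM; exact: (sum_stop_children dF uM).
have h1 : \sum_(W <- L) avg F1 (stop (dparent W)) * avg F2 (stop (dparent W)) * nu W <= 2 * B.
  apply: (@sum_stop_fiber nu (fun V => avg F1 V * avg F2 V)) => //.
  - by move=> V; rewrite mulr_ge0 ?avg0.
  - by move=> V _; rewrite -mulrA (avgK nu_gt0).
  - move=> V M uM /(sum_child_nu uM).
    have : 0 <= \sum_(W <- M) nu W by apply: sumr_ge0 => W _; exact: ltW.
    lra.
  - by move=> V; exact: ltW.
have h2 : \sum_(W <- L) F1 W * avg F2 (stop (dparent W)) <= 2 * B.
  under eq_bigr do rewrite mulrC.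
  apply: (@sum_stop_fiber F1 (avg F2)) => //.
  - by move=> V; exact: avg0.
  - by move=> V _; rewrite avgF mulrC.
  - by move=> V M; exact: child.
  - by move=> V; exact: F0.
have h3 : \sum_(W <- L) avg F1 (stop (dparent W)) * F2 W <= 2 * B.
  apply: (@sum_stop_fiber F2 (avg F1)) => //.
  - by move=> V; exact: avg0.
  - by move=> V M; exact: child.
  - by move=> V; exact: F0.
by move: h0 h1 h2 h3; lra.
Qed.

Lemma sum_near_part (L : seq dyadic) : uniq L ->
  \sum_(W <- L) (stop_part W + \sum_(V <- crosslist W) cross_weight (W, V)) <= 8 * B.
Proof.
move=> uL; rewrite big_split /= (_ : 8 * B = 7 * B + B); last by ring.
apply: lerD.
  rewrite -big_mkcond -big_filter; apply: sum_stop_weight; first exact: filter_uniq.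
  by move=> W; rewrite mem_filter => /andP[/eqP].
rewrite -(big_allpairs_dep (h := fun W V : dyadic => (W, V)) (F := cross_weight)).
apply: cross_bound.
  apply: allpairs_uniq_dep => //; first by move=> W _; exact: undup_uniq.
  by move=> [a b] [a' b'] _ _ /= [-> ->].
by move=> p /allpairsPdep[W [V [_ VW ->]]]; apply/mem_crosslist.
Qed.

(** For each of the [N + 3] values of [j], an interval has only one [j]-th ancestor [I]. *)
Lemma sum_near_sum (L : seq dyadic) : uniq L ->
  \sum_(I <- L) near_sum I <= (N + 3)%:R * (8 * B).
Proof.
move=> uL; rewrite /near_sum exchange_big /=.
have -> : (N + 3)%:R * (8 * B) = \sum_(j <- iota 0 N.+3) 8 * B.
  by rewrite big_const_seq count_predT size_iota iter_addr_0 mulr_natl addn3.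
apply: ler_sum => j _; rewrite sum_dlist_flatten.
exact/sum_near_part/uniq_dlist_flatten.
Qed.

Definition good J := stop (dleft J) == stop (dright J).

Lemma sum_good_osc F (x : dyadic -> R) (L : seq dyadic) : is_data F -> uniq L ->
    (forall V, 0 <= x V) -> (forall V, x V * (avg F V * F V) <= avg F1 V * F2 V) ->
  \sum_(J <- L | good J) x (stop (dleft J)) * (hmass J * osc F J ^+ 2) <= 8 * B.
Proof.
move=> dF uL x0 xF; rewrite -big_filter; set M := seq.filter _ _.
rewrite (sum_fiber _ (fun J => stop (dleft J))); set Vs := undup _.
apply: (@le_trans _ _ (\sum_(V <- Vs) 8 * (avg F1 V * F2 V))); last first.
  rewrite -mulr_sumr ler_wpM2l // stop_bound //; first exact: undup_uniq.
  by move=> W; rewrite mem_undup => /mapP[J _ ->]; exact: stop_idem.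
apply: ler_sum => V _; rewrite (eq_bigr (fun J => x V * (hmass J * osc F J ^+ 2))); last first.
  by move=> J /eqP->.
rewrite -mulr_sumr -big_filter.
have := @sum_osc_le _ nu F1 F2 r nu_gt0 nuD F V (seq.filter (fun J => stop (dleft J) == V) M) dF.
rewrite !filter_uniq // => /(_ isT) h.
apply: le_trans (ler_wpM2l (x0 V) (h _)) _.
  move=> J; rewrite !mem_filter => /and3P[/eqP e1 /eqP e2 _].
  by rewrite -e2.
by have := xF V; rewrite -mulrA; lra.
Qed.

Definition osc_part F (x : dyadic -> R) J :=
  if good J then x (stop (dleft J)) * (hmass J * osc F J ^+ 2) else 0.

(** The AM-GM weights, which turn [avg F V * F V] for either function into at most
    [avg F1 V * F2 V]. *)
Let x1 V := avg F2 V / avg F1 V.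
Let x2 V := avg F1 V / avg F2 V.
Let x1_ge0 V : 0 <= x1 V.
Proof. by apply: divr_ge0; exact: avg0. Qed.
Let x2_ge0 V : 0 <= x2 V.
Proof. by apply: divr_ge0; exact: avg0. Qed.

Lemma osc_part_ge0 F x J : (forall V, 0 <= x V) -> 0 <= osc_part F x J.
Proof.
move=> x0; rewrite /osc_part; case: ifP => // _.
by rewrite mulr_ge0 // mulr_ge0 ?sqr_ge0.
Qed.

Let coef2 F J : hmass J * osc F J ^+ 2 = haar_coef F J ^+ 2.
Proof. by rewrite exprMn sqr_sqrtr // real_normK // num_real. Qed.

Let coef_eq0 F J V : is_data F -> stop (dleft J) = V -> stop (dright J) = V ->
  avg F V = 0 -> haar_coef F J = 0.
Proof.
move=> dF e1 e2 e; apply: le_anti; rewrite haar_coef_ge0 andbT.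
by have := haar_coef_le J dF; rewrite e1 e2 e !(mulr0, addr0).
Qed.

(** If all four halves have the stopping interval of [I], AM-GM gives the oscillation terms;
    otherwise one of them serves as [x] in [haar_coef_near]. *)
Lemma haar_coefM_le s t I J J' : (s + t <= N)%N ->
    dancestor s J = I -> dancestor t J' = I ->
  haar_coef F1 J * haar_coef F2 J' <=
    (osc_part F1 x1 J + osc_part F2 x2 J') / 2 + near_const K * near_sum I.
Proof.
move=> stN EJ EJ'; have K0 : 0 < K := lt_le_trans ltr01 K1.
have D0 := near_const_gt0 K0.
have n0 : 0 <= near_const K * near_sum I by apply: mulr_ge0; [exact: ltW|exact: near_sum_ge0].
have o0 : 0 <= (osc_part F1 x1 J + osc_part F2 x2 J') / 2.
  by apply: divr_ge0 => //; apply: addr_ge0; exact: osc_part_ge0.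
have [/allP same|/allPn[x xin /eqP xI]] :=
    boolP (all (fun x => stop x == stop I) [:: dleft J; dright J; dleft J'; dright J']).
  apply: ler_wpDr => //.
  have [e1 e2] : stop (dleft J) = stop I /\ stop (dright J) = stop I.
    by split; apply/eqP/same; rewrite !inE eqxx ?orbT.
  have [e3 e4] : stop (dleft J') = stop I /\ stop (dright J') = stop I.
    by split; apply/eqP/same; rewrite !inE eqxx ?orbT.
  rewrite /osc_part /good e1 e2 e3 e4 eqxx !coef2.
  apply: weighted_amgm; rewrite ?avg0 //; first exact: coef_eq0 e1 e2.
  exact: coef_eq0 e3 e4.
apply: ler_wpDl => //; have := near_ok_sum (haar_coef_near stN EJ EJ' xin xI).
by rewrite ler_pdivrMr // [near_sum I * _]mulrC.
Qed.

(** Each [J] is counted [2^t] times, each [J'] [2^s] times and each [I] [2^(s+t)] times, all at most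
    [2^N]. The two oscillation sums contribute [4 * B] each. *)
Lemma sum_haar_coefM s t (L : seq dyadic) : (s + t <= N)%N -> uniq L ->
  \sum_(I <- L) \sum_(J <- dlist s I) \sum_(J' <- dlist t I)
     haar_coef F1 J * haar_coef F2 J' <=
  (2 ^ N)%:R * (8 + near_const K * ((N + 3)%:R * 8)) * B.
Proof.
move=> stN uL; have K0 : 0 < K := lt_le_trans ltr01 K1.
pose g1 J := osc_part F1 x1 J / 2; pose g2 J := osc_part F2 x2 J / 2.
pose w I := near_const K * near_sum I.
have g1_0 J : 0 <= g1 J by rewrite divr_ge0 // osc_part_ge0.
have g2_0 J : 0 <= g2 J by rewrite divr_ge0 // osc_part_ge0.
apply: (@le_trans _ _ (\sum_(I <- L) \sum_(J <- dlist s I) \sum_(J' <- dlist t I)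
    (g1 J + g2 J' + w I))).
  apply: ler_sum => I _; rewrite !big_seq; apply: ler_sum => J.
  rewrite mem_dlist => /eqP EJ; rewrite !big_seq; apply: ler_sum => J'.
  by rewrite mem_dlist => /eqP EJ'; rewrite -mulrDl; exact: haar_coefM_le EJ EJ'.
have e I : \sum_(J <- dlist s I) \sum_(J' <- dlist t I) (g1 J + g2 J' + w I) =
    (\sum_(J <- dlist s I) g1 J) *+ (2 ^ t) + (\sum_(J' <- dlist t I) g2 J') *+ (2 ^ s)
    + w I *+ (2 ^ (s + t)).
  under eq_bigr => J _.
    rewrite big_split big_split /= !big_const_seq !count_predT !size_dlist !iter_addr_0.
    over.
  rewrite big_split big_split /= !big_const_seq !count_predT !size_dlist !iter_addr_0.
  by rewrite sumrMnl expnD mulnC mulrnA.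
under eq_bigr do rewrite e.
rewrite 2!big_split /= !sumrMnl !sum_dlist_flatten -mulr_sumr.
have uD n := uniq_dlist_flatten n uL.
have b1 : \sum_(J <- flatten [seq dlist s x | x <- L]) g1 J <= 4 * B.
  rewrite -mulr_suml ler_pdivrMr // (_ : 4 * B * 2 = 8 * B); last by ring.
  rewrite -big_mkcond; apply: sum_good_osc => // V.
  rewrite /x1; have [->|n] := eqVneq (avg F1 V) 0.
    by rewrite invr0 mulr0 !mul0r.
  by rewrite mulrA divfK // avgF mulrC.
have b2 : \sum_(J <- flatten [seq dlist t x | x <- L]) g2 J <= 4 * B.
  rewrite -mulr_suml ler_pdivrMr // (_ : 4 * B * 2 = 8 * B); last by ring.
  rewrite -big_mkcond; apply: sum_good_osc => // V.
  rewrite /x2; have [->|n] := eqVneq (avg F2 V) 0.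
    by rewrite invr0 mulr0 mul0r mulr_ge0 // ?avg0 // F0.
  by rewrite mulrA divfK.
have D0 := near_const_gt0 K0.
have b3 := ler_wpM2l (ltW D0) (sum_near_sum uL).
have B0 := B_ge0.
have p2 n : (n <= N)%N -> (2 ^ n <= 2 ^ N)%N by move=> h; rewrite leq_exp2l.
have {p2} pw n (y z : R) : (n <= N)%N -> y <= z -> 0 <= z -> y *+ (2 ^ n) <= z *+ (2 ^ N).
  move=> nN yz z0; apply: (@le_trans _ _ (z *+ 2 ^ n)); first by rewrite ler_wMn2r.
  by rewrite ler_wpMn2l // p2.
have c3 : 0 <= near_const K * ((N + 3)%:R * (8 * B)).
  by apply: mulr_ge0 (ltW D0) (mulr_ge0 (ler0n _ _) (mulr_ge0 (ler0n _ _) B0)).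
have c4 : 0 <= 4 * B by exact: mulr_ge0 (ler0n _ _) B0.
have sN : (s <= N)%N := leq_trans (leq_addr _ _) stN.
have tN : (t <= N)%N := leq_trans (leq_addl _ _) stN.
have h := lerD (lerD (pw _ _ _ tN b1 c4) (pw _ _ _ sN b2 c4)) (pw _ _ _ stN b3 c3).
apply: le_trans h _; rewrite -!mulrnDl -[leRHS]mulrA [leRHS]mulr_natl; apply: ler_wMn2r.
by move: (near_const K) => D; lra.
Qed.

End Bound.
End Sums.

(** Dyadic intervals as sets, and their measure *)

Section Geometry.
Variable R : realType.

Lemma ditv_parent u : ditv R u `<=` ditv R (dparent u).
Proof.
by rewrite (ditvU R (dparent u)); case: (dchild_parent u) => <- x; [left|right].
Qed.

Lemma ditv_under u v : under u v -> ditv R u `<=` ditv R v.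
Proof.
move=> [n <-]; elim: n => [//|n IH]; apply: subset_trans IH _.
exact: ditv_parent.
Qed.

Lemma ditv_level_inj (x : R) u v : u.1 = v.1 -> ditv R u x -> ditv R v x -> u = v.
Proof.
case: u v => k j [l i] /= <- {l}; rewrite /ditv /= !in_itv /=.
have p : 0 < (2%:R : R) ^ (- k) by rewrite exprz_gt0.
move=> /andP[a1 a2] /andP[b1 b2].
have := le_lt_trans a1 b2; have := le_lt_trans b1 a2.
by rewrite !ltr_pM2l // !ltr_int => h1 h2; congr pair; lia.
Qed.

Lemma ditv_meet (x : R) u v : ditv R u x -> ditv R v x -> under u v \/ under v u.
Proof.
wlog le : u v / v.1 <= u.1 => [H|] xu xv.
  case: (leP v.1 u.1) => [/H|/ltW /H]; first exact.
  by move=> /(_ xv xu) []; [right|left].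
left; exists (absz (u.1 - v.1)); apply: (@ditv_level_inj x) => //.
  by rewrite dancestor1; lia.
by apply: ditv_under xu; eexists.
Qed.

Lemma ditv_children_disj u : [disjoint ditv R (dleft u) & ditv R (dright u)].
Proof.
apply/disj_setPS => x [xl xr]; case: (@dleft_neq_right u).
exact: (ditv_level_inj _ xl xr).
Qed.

Lemma measurable_ditv u : measurable (ditv R u : set (measurableTypeR R)).
Proof. exact: measurable_itv. Qed.

(** An interval not adjacent to the origin is separated from it by at least its own length. *)
Lemma ditv_far (r : int) u (x : R) : u.1 <= r -> u.2 <> dsign u -> ditv R u x ->
  2%:R ^ (- r) <= `|x|.
Proof.
case: u => k j /= kr; rewrite /dsign /= => js; rewrite /ditv /= in_itv /= => /andP[x1 x2].
have p : 0 < (2%:R : R) ^ (- k) by rewrite exprz_gt0.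
have le : (2%:R : R) ^ (- r) <= 2%:R ^ (- k).
  by rewrite ler_weXz2l ?ler1n // lerN2.
apply: le_trans le _; have [j1|jm] : 1 <= j \/ j + 1 <= -1.
  by move: js; case: ifP => ? ?; lia.
  apply: le_trans (ler_norm _); apply: le_trans x1.
  by rewrite ler_pMr // -[1]/(1%:~R) ler_int.
rewrite -normrN; apply: le_trans (ler_norm _); rewrite lerNr ltW // (lt_le_trans x2) //.
by rewrite -[leRHS]mulrN1 ler_pM2l // -[-1]/((-1)%:~R) ler_int.
Qed.

(** A distance of at most 2 would mean nested intervals or a common parent. *)
Lemma cross_ddist (S : dyadic -> Prop) N p : cross_pair S N p ->
  (2%:E < ddist R p.1 p.2 <= ((N + 2)%:R)%:E)%E.
Proof.
case=> _ _ n1 n2 [ne [i [j [ij E]]]]; apply/andP; split; last first.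
  apply: (@le_trans _ _ ((i + j)%:R)%:E).
    by apply: ereal_inf_lbound; exists (i, j).
  by rewrite lee_fin ler_nat.
apply: (@lt_le_trans _ _ 3%:E); first by rewrite lte_fin ltr_nat.
apply: le_ereal_inf_tmp => _ [[a b] /= e <-]; rewrite lee_fin ler_nat.
case: a e => [|[|[|a]]] e.
- by case: n2; exists b.
- case: b e => [|[|b]] e; [by case: n1; exists 1%N|by case: ne|lia].
- by case: b e => [|b] e; [case: n1; exists 2%N|lia].
- lia.
Qed.

Lemma cross_disj (S : dyadic -> Prop) N p : cross_pair S N p ->
  ditv R p.1 `&` ditv R p.2 = set0.
Proof.
by case=> _ _ n1 n2 _; rewrite -subset0 => x [x1 x2]; case: (ditv_meet x1 x2).
Qed.

End Geometry.

(** * Square-integrable functions, pairings and Haar coefficients *)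

Section Pairing.
Variable R : realType.
Variable mu : {measure set (measurableTypeR R) -> \bar R}.
Hypothesis mu_dyadic : forall I : dyadic, (0 < mu (ditv R I) < +oo)%E.
Local Notation L2 := (Lfun mu 2%:E).

Lemma vol_gt0 u : 0 < vol mu u.
Proof. by rewrite /vol fine_gt0. Qed.

Lemma mu_ditv u : mu (ditv R u) = (vol mu u)%:E.
Proof.
rewrite /vol fineK // ge0_fin_numE ?measure_ge0 //.
by case/andP: (mu_dyadic u).
Qed.

Lemma volD : dadditive (vol mu).
Proof.
move=> u; apply: EFin_inj; rewrite EFinD -!mu_ditv ditvU measureU //.
- exact: measurable_ditv.
- exact: measurable_ditv.
- exact/disj_set2P/ditv_children_disj.
Qed.

Lemma bounded_L2 (f : R -> R) (A : set (measurableTypeR R)) (M : R) :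
    measurable_fun setT (f : measurableTypeR R -> R) -> measurable A -> (mu A < +oo)%E ->
    (forall x, `|f x| <= M * \1_A x) -> f \in L2.
Proof.
move=> mf mA Afin fM; rewrite inE; apply/andP; split; first exact: mem_set.
apply: mem_set; rewrite /= /finite_norm unlock poweR_lty //.
apply: (@le_lt_trans _ _ (\int[mu]_x ((M ^+ 2)%:E * (\1_A x)%:E))%E).
  apply: ge0_le_integral => //.
  - by move=> x _; rewrite poweR_ge0.
  - apply/measurable_EFinP.
    apply/(@measurableT_comp _ _ _ _ _ _ (fun x : R => x `^ 2)%R) => //.
    exact/measurableT_comp.
  - by apply: measurable_funeM; apply/measurable_EFinP.
  move=> x _ /=; rewrite lee_fin powR_mulrn //.
  have := fM x; rewrite indicE; case: (x \in A) => /=; rewrite ?(mulr1, mulr0) => h.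
    by rewrite lerXn2r // nnegrE (le_trans _ h).
  by rewrite (@le_anti _ _ `|f x| 0) ?expr0n // h normr_ge0.
rewrite ge0_integralZl //; last by rewrite lee_fin sqr_ge0.
  by rewrite integral_indic // setIT lte_mul_pinfty // ?lee_fin ?sqr_ge0.
exact/measurable_EFinP.
Qed.

Lemma L2_integrable (f g : R -> R) : f \in L2 -> g \in L2 ->
  mu.-integrable setT (EFin \o (fun x => f x * g x)).
Proof. by move=> f2 g2; apply/Lfun1_integrable; exact: Lfun2_mul_Lfun1. Qed.

Let lmod := @Lfun_submod_closed _ _ R mu 2%:E (lee1n 2).

Lemma L2_lin (a : R) (f g : R -> R) : f \in L2 -> g \in L2 ->
  (fun x => a * f x + g x) \in L2.
Proof. by case: lmod => _ h; exact: h. Qed.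

Lemma L2_0 : (fun=> 0 : R) \in L2.
Proof. by case: lmod. Qed.

Lemma L2_scale (a : R) (f : R -> R) : f \in L2 -> (fun x => a * f x) \in L2.
Proof.
move=> f2; rewrite (_ : (fun x => _) = (fun x => a * f x + 0)); first exact: L2_lin L2_0.
by apply/funext => x; rewrite addr0.
Qed.

Lemma L2_sum (I : Type) (L : seq I) (f : I -> R -> R) : (forall i, f i \in L2) ->
  (fun x => \sum_(i <- L) f i x) \in L2.
Proof.
move=> f2; elim: L => [|i L IH].
  by under eq_fun do rewrite big_nil; exact: L2_0.
under eq_fun do rewrite big_cons -[f i _]mul1r.
exact: L2_lin.
Qed.

Lemma indic_L2 u : (\1_(ditv R u) : R -> R) \in L2.
Proof.
apply: (@bounded_L2 _ (ditv R u) 1).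
- exact: measurable_indic (measurable_ditv u).
- exact: measurable_ditv.
- by rewrite mu_ditv ltry.
- by move=> x; rewrite mul1r ger0_norm.
Qed.

Lemma haarE u : haar mu u = fun x => Num.sqrt (mass mu u) *
  (- (vol mu (dright u))^-1 * \1_(ditv R (dright u)) x +
   (vol mu (dleft u))^-1 * \1_(ditv R (dleft u)) x).
Proof. by apply/funext => x; rewrite /haar; ring. Qed.

Lemma haar_L2 u : haar mu u \in L2.
Proof.
rewrite haarE; apply: L2_scale; apply: L2_lin; first exact: indic_L2.
exact/L2_scale/indic_L2.
Qed.

Lemma pairing_lin (a : R) (f g h : R -> R) : f \in L2 -> g \in L2 -> h \in L2 ->
  pairing mu (fun x => a * f x + g x) h = a * pairing mu f h + pairing mu g h.
Proof.
move=> f2 g2 h2; rewrite /pairing -RintegralZl //; last exact: L2_integrable.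
rewrite -RintegralD //; try exact: L2_integrable.
  by apply: eq_Rintegral => x _; ring.
rewrite (_ : EFin \o _ = EFin \o (fun x => (a * f x) * h x)).
  by apply: L2_integrable => //; exact: L2_scale.
by apply/funext => x /=; rewrite mulrA.
Qed.

Lemma pairingC f g : pairing mu f g = pairing mu g f.
Proof. by apply: eq_Rintegral => x _; rewrite mulrC. Qed.

Lemma pairing_scale (a : R) (f h : R -> R) : f \in L2 -> h \in L2 ->
  pairing mu (fun x => a * f x) h = a * pairing mu f h.
Proof.
move=> f2 h2; rewrite /pairing -RintegralZl //; last exact: L2_integrable.
by apply: eq_Rintegral => x _; rewrite mulrA.
Qed.

Lemma pairing_sum (I : Type) (L : seq I) (f : I -> R -> R) h :
    (forall i, f i \in L2) -> h \in L2 ->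
  pairing mu (fun x => \sum_(i <- L) f i x) h = \sum_(i <- L) pairing mu (f i) h.
Proof.
move=> f2 h2; elim: L => [|i L IH].
  rewrite big_nil /pairing (@eq_Rintegral _ _ _ mu setT (fun=> 0)) ?Rintegral_cst ?mul0r //.
  by move=> x _; rewrite big_nil mul0r.
rewrite big_cons -IH -[X in X + _]mul1r -pairing_lin //; last exact: L2_sum.
by apply: eq_Rintegral => x _; rewrite big_cons mul1r.
Qed.

Definition dint (f : R -> R) u : R := \int[mu]_(x in ditv R u) f x.

Lemma averageE f u : average mu f u = avg (vol mu) (dint f) u.
Proof. by rewrite /average /avg mulrC. Qed.

Lemma pairing_indic f u : pairing mu f \1_(ditv R u) = dint f u.
Proof.
rewrite /pairing /dint [RHS]Rintegral_mkcond; apply: eq_Rintegral => x _.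
by rewrite patchE indicE; case: ifP; rewrite ?mulr1 ?mulr0.
Qed.

Lemma dintD f : f \in L2 -> dadditive (dint f).
Proof.
move=> f2 u; rewrite -!pairing_indic !(pairingC f) -[X in X + _]mul1r -pairing_lin //;
  try exact: indic_L2.
apply: eq_Rintegral => x _; rewrite mul1r; congr (_ * _); rewrite !indicE ditvU in_setU.
have /disj_setPS/(_ x) := @ditv_children_disj R u.
have [/set_mem xl|_] := boolP (x \in ditv R (dleft u)); have [/set_mem xr|_] := boolP (x \in ditv R (dright u)).
- by move=> /(_ (conj xl xr)).
- by rewrite addr0.
- by rewrite add0r.
- by rewrite addr0.
Qed.

Lemma pairing_haar f u : f \in L2 ->
  `|pairing mu f (haar mu u)| = haar_coef (vol mu) (dint f) u.
Proof.
move=> f2; rewrite /haar_coef /osc /avg -!pairing_indic pairingC.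
have l2 := indic_L2 (dleft u); have r2 := indic_L2 (dright u).
rewrite haarE.
rewrite pairing_scale // ?pairing_lin ?pairing_scale ?L2_lin ?L2_scale //.
rewrite normrM ger0_norm ?sqrtr_ge0 //; congr (_ * `|_|).
by rewrite !(pairingC f); ring.
Qed.

End Pairing.

(** * Test functions and their supports *)

Section TestFunctions.
Variable R : realType.
Variable mu : {measure set (measurableTypeR R) -> \bar R}.
Hypothesis mu_dyadic : forall I : dyadic, (0 < mu (ditv R I) < +oo)%E.
Local Notation L2 := (Lfun mu 2%:E).

(** The support condition places [f] inside the two roots of level [r]. *)
Definition supported_in (r : int) (f : R -> R) :=
  forall x, f x != 0 -> `|x| < 2%:R ^ (- r).

Lemma supported_in_le r r' f : r' <= r -> supported_in r f -> supported_in r' f.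
Proof.
move=> rr h x /h /lt_le_trans; apply.
by rewrite ler_weXz2l ?ler1n // lerN2.
Qed.

Lemma test_fun_supported f : test_fun f -> exists r, supported_in r f.
Proof.
case=> _ _ _ /compact_bounded [M [_ HM]].
pose M1 := Num.max (M + 1) 0.
have M1_gt : M < M1 by rewrite lt_max ltrDl ltr01.
have M1_ge0 : 0 <= M1 by rewrite le_max lexx orbT.
(* A negative level gives long roots; [n < 2^n] makes them longer than the bound on the support. *)
exists (- (Num.bound M1)%:Z) => x fx.
apply: (@le_lt_trans _ _ M1); first by apply: (HM _ M1_gt); exact: subset_closure.
rewrite opprK -exprnP (lt_trans (archi_boundP M1_ge0)) // -natrX ltr_nat.
exact: ltn_expl.
Qed.

Lemma test_fun_L2 f : test_fun f -> f \in L2.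
Proof.
move=> tf; have [r Hr] := test_fun_supported tf.
case: tf => mf _ [M [_ HM]] _.
have {}HM x : `|f x| <= M + 1 by apply: (HM (M + 1)); rewrite ?ltrDl.
pose v1 : dyadic := (r, -1); pose v2 : dyadic := (r, 0).
pose A : set (measurableTypeR R) := ditv R v1 `|` ditv R v2.
have mA : measurable A by apply: measurableU; exact: measurable_ditv.
apply: (@bounded_L2 _ mu _ A (M + 1)) => //.
  apply: (@le_lt_trans _ _ (mu (ditv R v1) + mu (ditv R v2))%E).
    by apply: measureU2; exact: measurable_ditv.
  by rewrite !(mu_ditv mu_dyadic) -EFinD ltry.
move=> x; rewrite indicE; have [xA|xA] := boolP (x \in A); first by rewrite mulr1.
have -> : f x = 0; last by rewrite normr0 mulr0.
apply/eqP; apply: contraNT xA => /Hr; rewrite ltr_norml => /andP[x1 x2].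
apply/mem_set; rewrite /A /v1 /v2 /ditv /= !in_itv /=.
rewrite !(mulN1r, mulrN1, addNr, mulr0, add0r, mulr1, mulr0z, mulrN) ?mulr1z ?mulr1.
by case: (ltP x 0) => h; [left|right]; rewrite ?(ltW x1).
Qed.

Lemma dint_ge0 f u : (forall x, 0 <= f x) -> 0 <= dint mu f u.
Proof. by move=> f0; apply: Rintegral_ge0. Qed.

Lemma dint_supp r f u : supported_in r f -> u.1 <= r -> u.2 <> dsign u -> dint mu f u = 0.
Proof.
move=> fr u1 u2; rewrite /dint (@eq_Rintegral _ _ _ mu _ (fun=> 0)).
  by rewrite Rintegral_cst ?mul0r //; exact: measurable_ditv.
move=> x /set_mem xu; apply/eqP; apply: contraT => /fr.
by rewrite ltNge (ditv_far u1 u2 xu).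
Qed.

End TestFunctions.

(** * Reduction of Haar shifts to finite sums *)

Section HaarShift.
Variable R : realType.
Variable mu : {measure set (measurableTypeR R) -> \bar R}.
Hypothesis mu_dyadic : forall I : dyadic, (0 < mu (ditv R I) < +oo)%E.
Local Notation L2 := (Lfun mu 2%:E).

Lemma descendantsE n I : descendants n I = [set` dlist n I].
Proof.
by apply/seteqP; split=> J /=; rewrite /descendants /= mem_dlist => /eqP.
Qed.

Lemma haar_blockE s t alpha f I x : haar_block mu s t alpha f I x =
  \sum_(J <- dlist s I) \sum_(K <- dlist t I)
    alpha I J K * pairing mu f (haar mu J) * haar mu K x.
Proof.
rewrite /haar_block !descendantsE -fsbig_seq ?dlist_uniq //.
by apply: eq_bigr => J _; rewrite -fsbig_seq ?dlist_uniq.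
Qed.

Lemma pairing_haar_sum s t alpha f g (L : seq dyadic) : f \in L2 -> g \in L2 ->
    (forall I J K, descendants s I J -> descendants t I K -> `|alpha I J K| <= 1) ->
  (fun x => \sum_(I <- L) haar_block mu s t alpha f I x) \in L2 /\
  `|pairing mu (fun x => \sum_(I <- L) haar_block mu s t alpha f I x) g| <=
    \sum_(I <- L) \sum_(J <- dlist s I) \sum_(K <- dlist t I)
      haar_coef (vol mu) (dint mu f) J * haar_coef (vol mu) (dint mu g) K.
Proof.
move=> f2 g2 a1.
have h1 I J K : (fun x => alpha I J K * pairing mu f (haar mu J) * haar mu K x) \in L2.
  exact/L2_scale/haar_L2.
have h2 I J : (fun x => \sum_(K <- dlist t I)
    alpha I J K * pairing mu f (haar mu J) * haar mu K x) \in L2 by apply: L2_sum.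
have h3 I : (haar_block mu s t alpha f I) \in L2.
  rewrite (_ : haar_block _ _ _ _ _ _ = fun x => \sum_(J <- dlist s I) \sum_(K <- dlist t I)
    alpha I J K * pairing mu f (haar mu J) * haar mu K x); first exact: L2_sum.
  by apply/funext => x; rewrite haar_blockE.
split; first exact: L2_sum.
rewrite pairing_sum //; apply: le_trans (ler_norm_sum _ _ _) _; apply: ler_sum => I _.
rewrite (_ : haar_block _ _ _ _ _ _ = fun x => \sum_(J <- dlist s I) \sum_(K <- dlist t I)
    alpha I J K * pairing mu f (haar mu J) * haar mu K x); last first.
  by apply/funext => x; rewrite haar_blockE.
rewrite pairing_sum //; apply: le_trans (ler_norm_sum _ _ _) _; rewrite !big_seq.
apply: ler_sum => J; rewrite mem_dlist => /eqP JI.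
rewrite pairing_sum //; apply: le_trans (ler_norm_sum _ _ _) _; rewrite !big_seq.
apply: ler_sum => K; rewrite mem_dlist => /eqP KI.
rewrite pairing_scale //; last exact: haar_L2.
rewrite !normrM (pairing_haar mu_dyadic) // pairingC (pairing_haar mu_dyadic) //.
rewrite ler_wpM2r ?haar_coef_ge0 // ler_piMl ?haar_coef_ge0 //.
exact: a1.
Qed.

Lemma pairing_le_Lnorm (f g : R -> R) : f \in L2 -> g \in L2 ->
  (`|pairing mu f g|%:E <= 'N[mu]_2%:E[EFin \o f] * 'N[mu]_2%:E[EFin \o g])%E.
Proof.
move=> f2 g2; have fg := L2_integrable f2 g2.
rewrite /pairing EFin_normr_Rintegral //.
apply: le_trans (le_abse_integral _ _ _) _ => //; first exact: measurable_int fg.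
rewrite -Lnorm1; apply: (@hoelder _ _ _ mu f g 2 2) => //.
- by move: f2; rewrite inE => /andP[/set_mem].
- by move: g2; rewrite inE => /andP[/set_mem].
- by rewrite [RHS]splitr !div1r.
Qed.

(** A finite partial sum is close to [T f] in L^2, and Cauchy-Schwarz bounds the pairing of the
    remainder with [g]. *)
Lemma HS_pairing_le s t T f g (X : R) : HS mu s t T -> f \in L2 -> g \in L2 ->
    (forall L : seq dyadic, uniq L ->
      \sum_(I <- L) \sum_(J <- dlist s I) \sum_(K <- dlist t I)
        haar_coef (vol mu) (dint mu f) J * haar_coef (vol mu) (dint mu g) K <= X) ->
  `|pairing mu (T f) g| <= X.
Proof.
move=> [alpha a1 HT] f2 g2 HX; have {HT} [Tf2 cv] := HT f f2.
set n := fun F : {fset dyadic} => _ in cv.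
have gfin : ('N[mu]_2%:E[EFin \o g] < +oo)%E by move: g2; rewrite inE => /andP[_ /set_mem].
have gr : 'N[mu]_2%:E[EFin \o g]%E = (fine 'N[mu]_2%:E[EFin \o g])%:E.
  by rewrite fineK // ge0_fin_numE ?Lnorm_ge0.
set G := fine _ in gr; have G0 : 0 <= G by rewrite fine_ge0 // Lnorm_ge0.
(* Dividing by [G + 1] also covers a [g] of norm 0. *)
apply/ler_addgt0Pr => e e0; have e'0 : 0 < e / (G + 1) by rewrite divr_gt0 // ltr_wpDl.
have [F HF] : exists F, (n F < (e / (G + 1))%:E)%E.
  have : nbhs (0%E : \bar R) [set y | (y < (e / (G + 1))%:E)%E].
    by apply: open_nbhs_nbhs; split; [exact: open_ereal_lt_ereal|rewrite /= lte_fin].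
  move=> /cv H; have [F HF] := @filter_ex _ _ summability.totally_filter (n @^-1` _) H.
  by exists F.
have [gF2 gFle] := pairing_haar_sum (enum_fset F) f2 g2 a1.
set h := (fun x => _) in gF2 gFle.
have dec : pairing mu (T f) g = pairing mu (fun x => -1 * h x + T f x) g + pairing mu h g.
  by rewrite pairing_lin // mulN1r addrAC addNr add0r.
rewrite dec addrC; apply: le_trans (ler_normD _ _) _; apply: lerD.
  by apply: le_trans gFle (HX _ _); exact: fset_uniq.
have d2 : (fun x => -1 * h x + T f x) \in L2 by exact: L2_lin.
have := pairing_le_Lnorm d2 g2; rewrite gr.
have -> : 'N[mu]_2%:E[EFin \o (fun x => (-1 * h x + T f x)%R)]%E = n F.
  by apply: eq_Lnorm => x /=; congr EFin; rewrite mulN1r addrC.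
move=> le; rewrite -lee_fin; apply: le_trans le _.
apply: (@le_trans _ _ ((e / (G + 1))%:E * G%:E)%E).
  by apply: lee_wpmul2r; [rewrite lee_fin|exact: ltW].
rewrite -EFinM lee_fin mulrAC ler_pdivrMr ?ltr_wpDl //.
by rewrite ler_wpM2l ?(ltW e0) // lerDl.
Qed.

End HaarShift.

(** * Sparseness of the stopping intervals *)

Section Sparse.
Variable R : realType.
Variable mu : {measure set (measurableTypeR R) -> \bar R}.
Hypothesis mu_dyadic : forall I : dyadic, (0 < mu (ditv R I) < +oo)%E.
Variables (F1 F2 : dyadic -> R) (r : int).
Local Notation nu := (vol mu).
Local Notation stop := (stop nu F1 F2 r).
Local Notation stop_child := (stop_child nu F1 F2 r).

Lemma bigcup_ditv_measurable (P : set dyadic) :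
  measurable (\bigcup_(W in P) ditv R W : set (measurableTypeR R)).
Proof.
rewrite bigcup_mkcond; apply: countable_bigcupT_measurable; first exact: countableP.
by move=> W; case: ifP => _; [exact: measurable_ditv|exact: measurable0].
Qed.

(** Countable subadditivity along an enumeration of the intervals, whose partial sums run over
    finite families. *)
Lemma mu_bigcup_le (P : dyadic -> Prop) (X : R) :
    (forall L : seq dyadic, uniq L -> (forall W, W \in L -> P W) ->
       \sum_(W <- L) nu W <= X) ->
  (mu (\bigcup_(W in [set W | P W]) ditv R W) <= X%:E)%E.
Proof.
move=> HX; pose A n : set (measurableTypeR R) :=
  if pickle_inv n is Some W then if `[< P W >] then ditv R W else set0 else set0.
have mA n : measurable (A n).
  by rewrite /A; case: pickle_inv => // W; case: ifP => // _; exact: measurable_ditv.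
apply: (@le_trans _ _ (\sum_(n <oo) mu (A n))%E).
  apply: measure_sigma_subadditive => //.
    exact: bigcup_ditv_measurable.
  move=> x [W PW Wx]; exists (choice.pickle W); first exact: Logic.I.
  by rewrite /A pickleK_inv; case: asboolP.
apply: lime_le; first exact: is_cvg_nneseries.
near=> m; rewrite /index_iota subn0.
pose L := [seq W <- pmap (@pickle_inv dyadic) (iota 0 m) | `[< P W >]].
apply: (@le_trans _ _ (\sum_(W <- L) nu W)%:E); last first.
  rewrite lee_fin; apply: HX.
    by apply/filter_uniq/(pmap_uniq (@pickle_invK dyadic))/iota_uniq.
  by move=> W; rewrite mem_filter => /andP[/asboolP].
rewrite /L; elim: (iota 0 m) => [|n s IH]; first by rewrite !big_nil.
rewrite big_cons /A /=; case: (pickle_inv n) => [W|] /=; last by rewrite measure0 add0e.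
case: ifP => _; last by rewrite measure0 add0e.
by rewrite big_cons EFinD mu_ditv // leeD2l.
Unshelve. all: by end_near.
Qed.

Hypotheses (dF1 : is_data nu F1 F2 r F1) (dF2 : is_data nu F1 F2 r F2).

(** The set of [V] is [V] minus its stopping children, which by [sum_child_nu] cover at most half of
    it. *)
Lemma sparse_stops : sparse mu (2^-1) [set W | stop W = W].
Proof.
pose U V := \bigcup_(W in [set W | stop_child V W]) ditv R W.
have mU V : measurable (U V : set (measurableTypeR R)).
  exact: bigcup_ditv_measurable.
exists (fun V => ditv R V `\` U V).
  move=> V _; split; first by apply: measurableD => //; exact: measurable_ditv.
    exact: subDsetl.
  have hU : (mu (U V) <= (nu V / 2)%:E)%E.
    apply: mu_bigcup_le => L uL HL; rewrite ler_pdivlMr // mulrC.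
    exact: (sum_child_nu (vol_gt0 mu_dyadic) dF1 dF2).
  have le : (mu (ditv R V) <= mu (ditv R V `\` U V) + mu (U V))%E.
    have mD : measurable (ditv R V `\` U V : set (measurableTypeR R)).
      by apply: measurableD => //; exact: measurable_ditv.
    apply: le_trans (measureU2 mu mD (mU V)).
    apply: le_measure; [apply: mem_set; exact: measurable_ditv|apply: mem_set; exact: measurableU|].
    by move=> x xV; have [xU|xU] := pselect (U V x); [right|left].
  move: le hU; rewrite (mu_ditv mu_dyadic).
  case: (mu (U V)) (measure_ge0 mu (U V)) => [y| |] // _;
    case: (mu (ditv R V `\` U V)) => [z| |] //; rewrite ?leey //.
  by rewrite -EFinD -EFinM !lee_fin; lra.
apply/trivIsetP => V W /= sV sW VW.
wlog WV : V W sV sW VW / under W V => [H|].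
  rewrite -subset0 => x [x1 x2]; have [[a _] [b _]] := (x1, x2).
  case: (ditv_meet a b) => h; last by rewrite -(H V W).
  by rewrite -(H W V) // eq_sym.
have [n En] := WV; rewrite -subset0 => x [[_ nU] [xW _]]; apply: nU.
(* The topmost stopping interval strictly below [V] on the way from [W] is a stopping child of [V]
   that contains [W]. *)
have := stop_dichotomy nu F1 F2 r n W.
rewrite En sV sW => -[WeV|]; first by rewrite WeV eqxx in VW.
case=> k [i [/andP[_ i_n] _ sX pX]]; exists (dancestor i W); last first.
  by apply: ditv_under xW; exists i.
split=> // XV; have := @dancestor_inj i n W; rewrite XV En => /(_ erefl) e.
by rewrite e ltnn in i_n.
Qed.

End Sparse.

(** * From finite sums to the forms, and the conclusion *)

Lemma sum_le_esum (R : realType) (T : choiceType) (S : set T) (a : T -> R) (L : seq T) :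
    uniq L -> (forall x, x \in L -> S x) ->
  ((\sum_(x <- L) a x)%:E <= \esum_(x in S) (a x)%:E)%E.
Proof.
move=> uL LS; apply: esum_ge; exists [set` L].
  by split; [exact: finite_seq|move=> x /= /LS].
by rewrite -fsbig_seq // sumEFin.
Qed.

Unset Implicit Arguments.

Theorem theorem2p3 (R : realType)
    (mu : {measure set (measurableTypeR R) -> \bar R})
    (mu_dyadic : forall I : dyadic, (0 < mu (ditv R I) < +oo)%E)
    (mu_balanced : balanced mu) (N : nat) :
  exists eta C : R, [/\ 0 < eta, eta < 1, 0 < C &
    forall s t : nat, (s + t <= N)%N ->
    forall T : (R -> R) -> (R -> R), HS mu s t T ->
    forall f1 f2 : R -> R, test_fun f1 -> test_fun f2 ->
    exists2 S : set dyadic, sparse mu eta S &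
      (`|pairing mu (T f1) f2|%:E
         <= C%:E * (sparse_form mu S f1 f2 + cross_form mu N S f1 f2))%E].
Proof.
have [_ [c c1 cB]] := mu_balanced.
have K0 : 0 < c ^+ (N + 2) by rewrite exprn_gt0 // (lt_le_trans ltr01).
pose C : R := (2 ^ N)%:R * (8%:R + near_const (c ^+ (N + 2)) * ((N + 3)%:R * 8%:R)).
have C0 : 0 < C.
  rewrite /C pmulr_rgt0 ?ltr0n ?expn_gt0 // ltr_wpDr ?ltr0n //.
  by rewrite mulr_ge0 ?(ltW (near_const_gt0 K0)) // mulr_ge0 ?ler0n.
exists 2^-1, C; split=> //; first by rewrite invf_lt1 ?ltr1n.
move=> s t stN T HT f1 f2 t1 t2.
have [r1 s1] := test_fun_supported t1; have [r2 s2] := test_fun_supported t2.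
(* The smaller level gives the larger roots, which contain both supports. *)
pose r := Num.min r1 r2.
have {}s1 : supported_in r f1 by apply: supported_in_le s1; rewrite /r ge_min lexx.
have {}s2 : supported_in r f2 by apply: supported_in_le s2; rewrite /r ge_min lexx orbT.
have L1 := test_fun_L2 mu_dyadic t1; have L2 := test_fun_L2 mu_dyadic t2.
have [_ f1_ge0 _ _] := t1; have [_ f2_ge0 _ _] := t2.
pose nu := vol mu; pose F1 := dint mu f1; pose F2 := dint mu f2.
have p1 u : 0 <= F1 u by exact: dint_ge0.
have p2 u : 0 <= F2 u by exact: dint_ge0.
have nu0 := vol_gt0 mu_dyadic; have nuD := volD mu_dyadic.
have dF1 : is_data nu F1 F2 r F1.
  by apply: is_data1 => //; [exact: dintD|move=> u; exact: dint_supp].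
have dF2 : is_data nu F1 F2 r F2.
  by apply: is_data2 => //; [exact: dintD|move=> u; exact: dint_supp].
have a1 u : 0 <= avg nu F1 u := avg_ge0 nu0 u dF1.
have a2 u : 0 <= avg nu F2 u := avg_ge0 nu0 u dF2.
exists [set W | stop nu F1 F2 r W = W]; first exact: sparse_stops.
set S := [set W | _].
have A0 : (0 <= sparse_form mu S f1 f2)%E.
  apply: esum_ge0 => I _; rewrite lee_fin !averageE mulr_ge0 ?(ltW (nu0 _)) //.
  exact: mulr_ge0 (a1 _) (a2 _).
have D0 : (0 <= cross_form mu N S f1 f2)%E.
  apply: esum_ge0 => p _; rewrite lee_fin !averageE mulr_ge0 ?sqrtr_ge0 //.
  by rewrite mulr_ge0 ?sqrtr_ge0 //; exact: mulr_ge0 (a1 _) (a2 _).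
set A := sparse_form _ _ _ _ in A0 *; set D := cross_form _ _ _ _ _ in D0 *.
(* An infinite right-hand side is trivial; a finite one serves as [B], since each form bounds its
   finite partial sums and the other form is nonnegative. *)
have [fin|] := boolP (A + D \is a fin_num); last first.
  by rewrite ge0_fin_numE ?adde_ge0 // -leNgt leye_eq => /eqP ->; rewrite gt0_muley ?leey ?lte_fin.
rewrite -(fineK fin) -EFinM lee_fin; set B := fine _.
have BE : B%:E = (A + D)%E by rewrite fineK.
apply: (HS_pairing_le mu_dyadic HT L1 L2) => L uL.
apply: (sum_haar_coefM nu0 nuD dF1 dF2 c1 cB _ _ stN uL).
  move=> M uM HM; rewrite -lee_fin BE; apply: (@le_trans _ _ A); last by rewrite leeDl.
  rewrite (eq_bigr (fun W => average mu f1 W * average mu f2 W * vol mu W)).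
    exact: sum_le_esum.
  by move=> W _; rewrite !averageE -[RHS]mulrA (avgK nu0).
move=> M uM HM; rewrite -lee_fin BE; apply: (@le_trans _ _ D); last by rewrite leeDr.
rewrite (eq_bigr (fun p => average mu f1 p.1 * average mu f2 p.2 *
     Num.sqrt (mass mu p.1) * Num.sqrt (mass mu p.2))).
  apply: sum_le_esum => // p /HM cp; have [Sp1 Sp2 _ _ _] := cp.
  by split=> //; [exact: cross_disj cp|exact: cross_ddist cp].
by move=> p _; rewrite !averageE.
Qed.
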